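(* There exist an absolute constant $C>0$ and, for every $M>0$, a constant $c_M>0$ depending only on $M$, such that the following holds. Let $d\ge 1$, $p\in[1,\infty]$, $\mu>0$, $M>0$, $\varepsilon>0$, $\sigma\in(0,1)$. Let $X\subset\mathbb{R}^d$ be a convex set, let $\xi$ be a random variable, and let $f(x,\xi)\ge 0$ satisfy, for all $x,y\in X$ and all $\xi$, $$|f(y,\xi)-f(x,\xi)|\le M\|y-x\|_p ,$$ $$f(y,\xi)\ge f(x,\xi)+\langle\nabla_x f(x,\xi),y-x\rangle+\frac{\mu}{2}\|y-x\|_p^2 .$$ Put $F(x)=\mathbb{E}_\xi f(x,\xi)$. Let $\xi^1,\dots,\xi^N$ be i.i.d. copies of $\xi$, put $\hat F(x)=\frac1N\sum_{k=1}^N f(x,\xi^k)$, and suppose $$N\ \ge\ C\,\frac{M^2}{\mu\varepsilon}\left(\ln\left(\frac{M^2}{\mu\varepsilon}\right)+\ln\ln\left(\frac1\sigma\right)\right)\ln\left(\frac1\sigma\right),\qquad 0\le\delta\le c_M\,\mu\varepsilon^2 .$$ Let $x(\{\xi^k\}_{k=1}^N)\in X$ be any (measurable) function of the sample such that $$\mathbb{P}\left(\hat F\left(x(\{\xi^k\}_{k=1}^N)\right)-\min_{x\in X}\hat F(x)\le\delta\right)\ge 1-\frac{\sigma}{2}.$$ Then $$\mathbb{P}\left(F\left(x(\{\xi^k\}_{k=1}^N)\right)-\min_{x\in X}F(x)\le\varepsilon\right)\ge 1-\sigma .$$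
   Context: $\|\cdot\|_p$ is the $\ell_p$-norm on $\mathbb{R}^d$. $\nabla_x f(x,\xi)$ is the gradient of $f$ in $x$ (assumed to exist), and the minima of $F$ and $\hat F$ over $X$ are assumed to be attained. Convention for the lower bound on $N$: each logarithmic factor $\ln(M^2/(\mu\varepsilon))$, $\ln\ln(1/\sigma)$, $\ln(1/\sigma)$ is understood as the maximum of itself and $1$. *)

(* Defs.v *)
From HB Require Import structures.
From mathcomp Require Import all_boot all_order all_algebra.
From mathcomp Require Import all_classical all_reals all_analysis.

Set Implicit Arguments.
Unset Strict Implicit.
Unset Printing Implicit Defensive.

Import Order.TTheory GRing.Theory Num.Theory.
Import numFieldNormedType.Exports.

Local Open Scope classical_set_scope.
Local Open Scope ring_scope.

Section Euclidean.
Context {R : realType} {d : nat}.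
Implicit Types (x y : 'rV[R]_d) (X : set 'rV[R]_d) (G : 'rV[R]_d -> R).

(* Only used for 1 <= p <= +oo; the value at p = -oo is junk. *)
Definition lp_norm (p : \bar R) x : R :=
  match p with
  | r%:E => (\sum_(i < d) `|x 0 i| `^ r) `^ r^-1
  | +oo%E => \big[Num.max/0]_(i < d) `|x 0 i|
  | -oo%E => 0
  end.

Definition dotp x y : R := \sum_(i < d) x 0 i * y 0 i.

Definition gradient G x : 'rV[R]_d := \row_(i < d) 'D_(delta_mx 0 i) G x.

Definition attains_min X G :=
  exists2 x, X x & forall y, X y -> G x <= G y.

(* The minimum of G over X whenever [attains_min X G] holds. *)
Definition min_over X G : R := inf [set G x | x in X].

(* Borel measurability of a map into R^d: the target carries the
   sigma-algebra generated by the open sets. *)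
Definition borel_measurable d' (T : measurableType d') (h : T -> 'rV[R]_d) :=
  measurable_fun [set: T] (h : T -> g_sigma_algebraType (@open 'rV[R]_d)).

End Euclidean.

Section Probability.
Local Open Scope ereal_scope.
Context {R : realType} {dO dE : measure_display}.
Context {Omega : measurableType dO} {E : measurableType dE}.
Variable P : probability Omega R.

Definition mutually_independent (I : finType) (xis : I -> {RV P >-> E}) :=
  forall (J : {set I}) (A : I -> set E),
    (forall k, k \in J -> measurable (A k)) ->
    P (\bigcap_(k in [set` J]) (xis k @^-1` A k)) =
    \prod_(k in J) P (xis k @^-1` A k).

Definition same_distribution (xi xi' : {RV P >-> E}) :=
  forall A : set E, measurable A -> distribution P xi A = distribution P xi' A.

Definition iid_copies (I : finType) (xi : {RV P >-> E})
    (xis : I -> {RV P >-> E}) :=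
  mutually_independent xis /\ forall k, same_distribution (xis k) xi.

End Probability.

Section StochasticProgram.
Context {R : realType} {d : nat} {dE : measure_display}.
Context {E : measurableType dE}.
Variable f : 'rV[R]_d -> E -> R.

Definition risk {dO : measure_display} {Omega : measurableType dO}
    (P : probability Omega R) (xi : {RV P >-> E}) (x : 'rV[R]_d) : R :=
  fine ('E_P[fun w => f x (xi w)])%E.

Definition empirical_risk (N : nat) (s : N.-tuple E) (x : 'rV[R]_d) : R :=
  N%:R^-1 * \sum_(k < N) f x (tnth s k).

End StochasticProgram.

Definition sample {R : realType} {dO dE : measure_display}
    {Omega : measurableType dO} {E : measurableType dE}
    (P : probability Omega R) (N : nat) (xis : 'I_N -> {RV P >-> E})
    (w : Omega) : N.-tuple E :=
  [tuple xis k w | k < N].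

Definition ln_max1 {R : realType} (t : R) : R := Num.max (ln t) 1.

(* Main.v *)
Require Import Defs.
From HB Require Import structures.
From mathcomp Require Import all_boot all_order all_algebra.
From mathcomp Require Import all_classical all_reals all_analysis.
From mathcomp Require Import measurable_realfun.
From mathcomp Require Import zify ring lra.

Set Implicit Arguments.
Unset Strict Implicit.
Unset Printing Implicit Defensive.

Import Order.TTheory GRing.Theory Num.Theory.
Import numFieldNormedType.Exports.

Local Open Scope classical_set_scope.
Local Open Scope ring_scope.

(** The argument is a stability argument.  Let [s] be the sample, and let
[x s] be a point of [X] that minimizes the empirical risk up to a tiny error.

Geometry.  Only the midpoint form of strong convexity is used
([strongly_midconvex]): it passes to averages and expectations.  It bounds
the squared distance of two points by [4 / mu] times the sum of their
excesses over a lower bound ([strongly_midconvex_dist]).  Hence [x s] moves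
by [O(M / (N * mu))] when one observation is replaced
([near_minimizer_stable]), any point of nearly minimal empirical risk has
nearly the risk of [x s], and the losses
[a (s, e) = f (x s) e - f xstar e], where [xstar] minimizes the risk, satisfy
the Bernstein condition [a ^ 2 <= V * abar] with [V = O(M ^ 2 / mu)], where
[abar s] is the mean of [a (s, .)], that is, the excess risk of [x s]
([near_minimizer_bernstein]).

Concentration.  It remains to bound the exponential moment of [N * abar] for
a uniformly stable algorithm that nearly minimizes its empirical loss
([stable_excess_moment_le]).  Let [s'] be an independent copy of [s].  Up to
[3 * N * b], with [b] the stability constant, [N * abar s] is at most the sum
over [i] of [abar t - a (t, s_i)], where [t] is [s] with its [i]-th entry
taken from [s'].  In [t] the entry [i] is enlarged step by step to the dyadic
blocks that contain it, until [t = s'].  At each step the contribution of a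
block is, given all other observations, a sum of independent centred
variables, each a difference of losses at two samples that differ on the
sibling block only; exchanging entries of [s] and [s'] on that block changes
the sign of this difference, so that it is subgaussian
([expR_sqr_symmetric_le]), and the block has a bounded exponential moment at
scale [N * b] ([block_moment_le]).  Blocks and levels are combined by
convexity of the exponential, which costs the logarithmic number [L] of
levels.  The last term compares [s] with the independent sample [s']; by the
Bernstein condition its exponential moment is controlled by that of a small
multiple of [N * abar] itself ([top_level_moment_le]), which closes the
estimate.

Conclusion.  Markov's inequality and [sample_size] give the tail bound
([near_minimizer_excess]).  The points [x s] are chosen in a countable dense
sequence of [X]: then all the maps involved are measurable, and no minimizer
has to exist for the samples with exchanged entries. *)

(** * Bounded measurable functions *)

(** Bounded measurable real functions.  The integrands of the concentration
argument are of this kind, so that their integrals can be handled as real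
numbers. *)
Definition bmeas {d} {T : measurableType d} {R : realType} (f : T -> R) :=
  measurable_fun [set: T] f /\ exists B, forall x, `|f x| <= B.

Section BoundedMeasurable.
Context {d : measure_display} {T : measurableType d} {R : realType}.
Implicit Types f g : T -> R.

Lemma bmeas_cst (r : R) : bmeas (fun _ : T => r).
Proof. by split; [exact: measurable_cst|exists `|r|]. Qed.

Lemma bmeasD f g : bmeas f -> bmeas g -> bmeas (fun x => f x + g x).
Proof.
move=> [mf [B fB]] [mg [C gC]]; split; first exact: measurable_funD.
exists (B + C) => x; rewrite (le_trans (ler_normD _ _))//.
by rewrite lerD.
Qed.

Lemma bmeasM f g : bmeas f -> bmeas g -> bmeas (fun x => f x * g x).
Proof.
move=> [mf [B fB]] [mg [C gC]]; split; first exact: measurable_funM.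
by exists (B * C) => x; rewrite normrM ler_pM.
Qed.

Lemma bmeasN f : bmeas f -> bmeas (fun x => - f x).
Proof.
move=> [mf [B fB]]; split; first exact: measurable_funN.
by exists B => x; rewrite normrN.
Qed.

Lemma bmeasB f g : bmeas f -> bmeas g -> bmeas (fun x => f x - g x).
Proof. by move=> bf bg; apply: bmeasD => //; exact: bmeasN. Qed.

Lemma bmeasX f k : bmeas f -> bmeas (fun x => f x ^+ k).
Proof.
move=> [mf [B fB]]; split; first exact: measurable_funX.
by exists (B ^+ k) => x; rewrite normrX lerXn2r// nnegrE (le_trans _ (fB x)).
Qed.

Lemma bmeas_expR f : bmeas f -> bmeas (fun x => expR (f x)).
Proof.
move=> [mf [B fB]]; split; first exact: measurableT_comp.
exists (expR B) => x; rewrite ger0_norm ?expR_ge0// ler_expR.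
by rewrite (le_trans (ler_norm _)).
Qed.

Lemma bmeas_sum I (r : seq I) (p : pred I) (F : I -> T -> R) :
  (forall i, bmeas (F i)) -> bmeas (fun x => \sum_(i <- r | p i) F i x).
Proof.
move=> bF; elim: r => [|i r IH].
  by under eq_fun do rewrite big_nil; exact: bmeas_cst.
under eq_fun do rewrite big_cons.
by case: (p i) => //; exact: bmeasD.
Qed.

Lemma bmeas_comp d' (T' : measurableType d') (h : T' -> T) f :
  measurable_fun [set: T'] h -> bmeas f -> bmeas (fun x => f (h x)).
Proof.
move=> mh [mf [B fB]]; split; first exact: measurableT_comp.
by exists B => x.
Qed.

Variable P : probability T R.

Lemma bmeas_integrable f : bmeas f -> P.-integrable [set: T] (EFin \o f).
Proof.
move=> [mf [B fB]]; apply: measurable_bounded_integrable => //.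
  exact: le_lt_trans (probability_le1 P measurableT) (ltry 1).
by exists B; split; [exact: num_real|move=> M BM x _; apply: le_trans (fB x) _; exact: ltW].
Qed.

Lemma bint_cst (r : R) : \int[P]_x r = r.
Proof.
rewrite Rintegral_cst// (_ : fine _ = 1) ?mulr1//.
by transitivity (fine (1%E : \bar R)) => //; congr fine; exact: probability_setT.
Qed.

Lemma bintD f g : bmeas f -> bmeas g ->
  \int[P]_x (f x + g x) = \int[P]_x f x + \int[P]_x g x.
Proof. by move=> bf bg; rewrite RintegralD//; exact: bmeas_integrable. Qed.

Lemma bintB f g : bmeas f -> bmeas g ->
  \int[P]_x (f x - g x) = \int[P]_x f x - \int[P]_x g x.
Proof. by move=> bf bg; rewrite RintegralB//; exact: bmeas_integrable. Qed.

Lemma bintZ (r : R) f : bmeas f -> \int[P]_x (r * f x) = r * \int[P]_x f x.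
Proof. by move=> bf; rewrite RintegralZl//; exact: bmeas_integrable. Qed.

Lemma bint_le f g : bmeas f -> bmeas g -> (forall x, f x <= g x) ->
  \int[P]_x f x <= \int[P]_x g x.
Proof. by move=> bf bg fg; apply: le_Rintegral => //; exact: bmeas_integrable. Qed.

Lemma bint_le_cst f (c : R) : bmeas f -> (forall x, f x <= c) ->
  \int[P]_x f x <= c.
Proof.
by move=> bf fc; rewrite -[leRHS]bint_cst; apply: bint_le => //; exact: bmeas_cst.
Qed.

Lemma cst_le_bint f (c : R) : bmeas f -> (forall x, c <= f x) ->
  c <= \int[P]_x f x.
Proof.
by move=> bf fc; rewrite -[leLHS]bint_cst; apply: bint_le => //; exact: bmeas_cst.
Qed.

Lemma bint_sum I (r : seq I) (F : I -> T -> R) : (forall i, bmeas (F i)) ->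
  \int[P]_x (\sum_(i <- r) F i x) = \sum_(i <- r) \int[P]_x F i x.
Proof.
move=> bF; elim: r => [|i r IH].
  under eq_Rintegral do rewrite big_nil.
  by rewrite bint_cst big_nil.
under eq_Rintegral do rewrite big_cons.
by rewrite bintD ?IH ?big_cons//; exact: bmeas_sum.
Qed.

(** Jensen's inequality for the exponential, by its tangent at the mean. *)
Lemma expR_bint_le f : bmeas f ->
  expR (\int[P]_x f x) <= \int[P]_x expR (f x).
Proof.
move=> bf; set m := \int[P]_x f x.
have -> : expR m = \int[P]_x (expR m * (1 - m) + expR m * f x).
  rewrite bintD ?bint_cst ?bintZ//; [|exact: bmeas_cst|].
    by rewrite -/m; ring.
  by apply: bmeasM => //; exact: bmeas_cst.
apply: bint_le; [| exact: bmeas_expR|].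
  by apply: bmeasD; [exact: bmeas_cst|apply: bmeasM => //; exact: bmeas_cst].
move=> x; rewrite -mulrDr -[X in _ <= expR X](subrKC m) expRD ler_pM2l ?expR_gt0//.
by apply: le_trans (expR_ge1Dx _); rewrite addrAC addrA.
Qed.

Lemma sqr_bint_le f : bmeas f -> (\int[P]_x f x) ^+ 2 <= \int[P]_x (f x ^+ 2).
Proof.
move=> bf; set m := \int[P]_x f x.
have -> : m ^+ 2 = \int[P]_x (- m ^+ 2 + (2 * m) * f x).
  rewrite bintD ?bint_cst ?bintZ//; [|exact: bmeas_cst|].
    by rewrite -/m; ring.
  by apply: bmeasM => //; exact: bmeas_cst.
apply: bint_le; [| exact: bmeasX|].
  by apply: bmeasD; [exact: bmeas_cst|apply: bmeasM => //; exact: bmeas_cst].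
move=> x; rewrite -subr_ge0.
have -> : f x ^+ 2 - (- m ^+ 2 + 2 * m * f x) = (f x - m) ^+ 2 by ring.
exact: sqr_ge0.
Qed.

(** Jensen's inequality for a power, by its tangent at the mean. *)
Lemma exprn_bint_le f k : bmeas f -> (forall x, 0 <= f x) ->
  (\int[P]_x f x) ^+ k <= \int[P]_x (f x ^+ k).
Proof.
move=> bf f0; set m := \int[P]_x f x.
have m0 : 0 <= m by exact: cst_le_bint.
(* tangent inequality, by induction on the exponent *)
have tan x : m ^+ k + k%:R * m ^+ k.-1 * (f x - m) <= f x ^+ k.
  elim: k => [|k IH]; first by rewrite !expr0 mul0r mul0r addr0.
  have := f0 x; move: (f x) IH => y IH y0.
  rewrite (exprS y) /=; apply: le_trans (ler_wpM2l y0 IH).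
  case: k {IH} => [|k]; first by rewrite /= !expr0 expr1; lra.
  rewrite /= !exprS -[k.+2]addn1 natrD.
  have mk : 0 <= m ^+ k by exact: exprn_ge0.
  have kk : 0 <= k.+1%:R :> R by exact: ler0n.
  rewrite -subr_ge0; move: mk kk; move: (m ^+ k) (k.+1%:R : R) => u v u0 v0.
  have -> : y * (m * u + v * u * (y - m)) -
    (m * (m * u) + (v + 1) * (m * u) * (y - m)) = v * u * (y - m) ^+ 2 by ring.
  by rewrite mulr_ge0 ?sqr_ge0// mulr_ge0.
have -> : m ^+ k = \int[P]_x
    ((m ^+ k - k%:R * m ^+ k.-1 * m) + (k%:R * m ^+ k.-1) * f x).
  rewrite bintD ?bint_cst ?bintZ//; [|exact: bmeas_cst|].
    by rewrite -/m; ring.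
  by apply: bmeasM => //; exact: bmeas_cst.
apply: bint_le; [| exact: bmeasX|].
  by apply: bmeasD; [exact: bmeas_cst|apply: bmeasM => //; exact: bmeas_cst].
move=> x; apply: le_trans (tan x).
by rewrite le_eqVlt; apply/orP; left; apply/eqP; ring.
Qed.

End BoundedMeasurable.

Section BoundedFubini.
Context {d1 d2 : measure_display} {T1 : measurableType d1}
  {T2 : measurableType d2} {R : realType}.
Variables (P1 : probability T1 R) (P2 : probability T2 R).
Implicit Types f : T1 * T2 -> R.

Lemma bmeas_pairl f x : bmeas f -> bmeas (fun y => f (x, y)).
Proof. by move=> bf; apply: bmeas_comp bf; exact: measurable_fun_pair. Qed.

Lemma bmeas_pairr f y : bmeas f -> bmeas (fun x => f (x, y)).
Proof. by move=> bf; apply: bmeas_comp bf; exact: measurable_fun_pair. Qed.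

Lemma bmeas_bint f : bmeas f -> bmeas (fun x => \int[P2]_y f (x, y)).
Proof.
move=> bf; have [mf [B fB]] := bf; split.
  have mF := @measurable_fubini_F _ _ _ _ _ (@dirac _ T1 point R) P2 (EFin \o f)
    (bmeas_integrable _ bf).
  exact: (measurableT_comp (fine_measurable measurableT) mF).
exists B => x; rewrite ler_norml; apply/andP; split.
  apply: cst_le_bint; first exact: bmeas_pairl.
  by move=> y; have := fB (x, y); rewrite ler_norml => /andP[].
apply: bint_le_cst; first exact: bmeas_pairl.
by move=> y; have := fB (x, y); rewrite ler_norml => /andP[].
Qed.

Lemma bmeas_swap f : bmeas f -> bmeas (fun w : T2 * T1 => f (w.2, w.1)).
Proof. by move=> bf; apply: bmeas_comp bf; exact: measurable_fun_pair. Qed.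

Lemma bint_prod f : bmeas f ->
  \int[(P1 \x P2)%E]_z f z = \int[P1]_x \int[P2]_y f (x, y).
Proof.
move=> bf; rewrite [in LHS]/Rintegral.
rewrite -(@integral12_prod_meas1 _ _ _ _ _ P1 P2 (EFin \o f))//; last first.
  exact: bmeas_integrable.
rewrite /Rintegral; congr fine; apply: eq_integral => x _ /=.
by rewrite fineK//; apply: integrable_fin_num => //;
  apply: bmeas_integrable; exact: bmeas_pairl.
Qed.

End BoundedFubini.

Lemma bint_exchange {d1 d2 : measure_display} {T1 : measurableType d1}
  {T2 : measurableType d2} {R : realType}
  (P1 : probability T1 R) (P2 : probability T2 R) (f : T1 * T2 -> R) :
  bmeas f ->
  \int[P1]_x \int[P2]_y f (x, y) = \int[P2]_y \int[P1]_x f (x, y).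
Proof.
move=> bf; rewrite -bint_prod// [in LHS]/Rintegral.
rewrite -(@integral21_prod_meas1 _ _ _ _ _ P1 P2 (EFin \o f))//; last first.
  exact: bmeas_integrable.
rewrite /Rintegral; congr fine; apply: eq_integral => x _ /=.
by rewrite fineK//; apply: integrable_fin_num => //;
  apply: bmeas_integrable; exact: bmeas_pairr.
Qed.

(** * Exponential moment inequalities *)

(** The elementary inequality behind all the moment bounds: the exponential
of a centred variable costs only the exponential of its square. *)
Lemma expR_le_linear_sqr {R : realType} (x : R) :
  expR x <= x + expR (2 * x ^+ 2).
Proof.
have [x1|x1] := leP x 1; last first.
  have : expR x <= expR (2 * x ^+ 2) by rewrite ler_expR; nra.
  by lra.
suff : expR x <= 1 + x + 2 * x ^+ 2.
  by have := expR_ge1Dx (2 * x ^+ 2); lra.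
have h : expR (- (x / 2)) >= 1 - x / 2 by exact: expR_ge1Dx.
have h2 : (1 - x / 2) ^+ 2 * expR x <= 1.
  have g0 : 0 <= 1 - x / 2 by lra.
  have e1 : expR (- (x / 2)) ^+ 2 * expR x = 1.
    by rewrite expr2 -!expRD (_ : _ + x = 0) ?expR0//; field.
  by rewrite -[leRHS]e1 ler_wpM2r ?expR_ge0// lerXn2r ?nnegrE ?expR_ge0.
have p0 : 0 < (1 - x / 2) ^+ 2 by rewrite exprn_gt0//; lra.
rewrite -(ler_pM2l p0) (le_trans h2)// -subr_ge0.
have -> : (1 - x / 2) ^+ 2 * (1 + x + 2 * x ^+ 2) - 1 =
  x ^+ 2 * ((1 - x) * (5 / 4 - x / 2)) by field.
by rewrite mulr_ge0 ?sqr_ge0// mulr_ge0; lra.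
Qed.

Lemma cosh_le_expR_sqr {R : realType} (x : R) :
  (expR x + expR (- x)) / 2 <= expR (2 * x ^+ 2).
Proof.
have := expR_le_linear_sqr x; have := expR_le_linear_sqr (- x).
by rewrite sqrrN; lra.
Qed.

(** Jensen's inequality for the exponential of a finite mean. *)
Lemma expR_mean_le {R : realType} (I : Type) (r : seq I) (F : I -> R) :
  (0 < size r)%N ->
  expR ((size r)%:R^-1 * \sum_(i <- r) F i) <=
    (size r)%:R^-1 * \sum_(i <- r) expR (F i).
Proof.
move=> r0; set n := (size r)%:R : R; set m := n^-1 * _.
have n0 : 0 < n by rewrite ltr0n.
rewrite -(ler_pM2l n0) mulrA divff ?gt_eqF// mul1r.
have -> : n * expR m = \sum_(i <- r) (expR m * (1 - m) + expR m * F i).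
  rewrite big_split/= big_const_seq count_predT iter_addr_0 -mulr_sumr.
  have -> : \sum_(i <- r) F i = n * m by rewrite mulVKf ?gt_eqF.
  by rewrite -mulr_natl -/n; ring.
apply: ler_sum => i _; rewrite -mulrDr -[X in _ <= expR X](subrKC m) expRD.
rewrite ler_pM2l ?expR_gt0//; apply: le_trans (expR_ge1Dx _).
by rewrite addrAC addrA.
Qed.

Section CentredMoment.
Context {d : measure_display} {T : measurableType d} {R : realType}.
Variable P : probability T R.
Implicit Types h : T -> R.

(** The square on the right is not centred, so that it can be estimated
separately for each fixed [x]. *)
Lemma expR_centred_le h : bmeas h ->
  \int[P]_x expR (\int[P]_y h y - h x) <= \int[P]_x expR (8 * h x ^+ 2).
Proof.
move=> bh; set m := \int[P]_y h y.
have bm : bmeas (fun x => m - h x) by apply: bmeasB => //; exact: bmeas_cst.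
have b2 (c : R) : bmeas (fun x => c * h x ^+ 2).
  by apply: bmeasM; [exact: bmeas_cst|exact: bmeasX].
have b4 : bmeas (fun x => expR (4 * h x ^+ 2)) by exact: bmeas_expR.
set W := \int[P]_x expR (4 * h x ^+ 2).
have W1 : expR (4 * m ^+ 2) <= W.
  apply: le_trans (expR_bint_le P (b2 4)); rewrite ler_expR bintZ; last first.
    exact: bmeasX.
  by rewrite ler_pM2l// sqr_bint_le.
(* the linear term integrates to zero *)
have step1 : \int[P]_x expR (m - h x) <= expR (4 * m ^+ 2) * W.
  have -> : expR (4 * m ^+ 2) * W =
      \int[P]_x ((m - h x) + expR (4 * m ^+ 2) * expR (4 * h x ^+ 2)).
    rewrite bintD ?bintZ// ?bintB ?bint_cst//; last 2 first.
    - exact: bmeas_cst.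
    - by apply: bmeasM => //; exact: bmeas_cst.
    by rewrite subrr add0r.
  apply: bint_le; first exact: bmeas_expR.
    by apply: bmeasD => //; apply: bmeasM => //; exact: bmeas_cst.
  move=> x; apply: le_trans (expR_le_linear_sqr _) _.
  rewrite lerD2l -expRD ler_expR -subr_ge0.
  have -> : 4 * m ^+ 2 + 4 * h x ^+ 2 - 2 * (m - h x) ^+ 2 =
    2 * (m + h x) ^+ 2 by ring.
  by rewrite mulr_ge0// sqr_ge0.
apply: le_trans step1 _; apply: (@le_trans _ _ (W ^+ 2)).
  by rewrite expr2 ler_wpM2r//; apply: le_trans W1; exact: expR_ge0.
apply: le_trans (exprn_bint_le P 2 b4 (fun=> expR_ge0 _)) _.
apply: bint_le; [exact: bmeasX|exact: bmeas_expR|] => x.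
by rewrite -expRM_natl ler_expR mulrA -natrM.
Qed.

End CentredMoment.

(** * Concentration under sign symmetries *)

Section Symmetries.
Context {d : measure_display} {T : measurableType d} {R : realType}.
Variable P : probability T R.
Context {I : Type}.
Variable s : I -> T -> T.
Hypothesis ms : forall i, measurable_fun [set: T] (s i).
Hypothesis sK : forall i, involutive (s i).
Hypothesis sC : forall i j x, s i (s j x) = s j (s i x).
Hypothesis sP : forall i (f : T -> R), bmeas f ->
  \int[P]_x f (s i x) = \int[P]_x f x.

(** A bounded-differences inequality: [Y] changes little under each of
finitely many commuting measure-preserving involutions, and changes sign
under their product, so that its mean over the orbits vanishes.  The
involutions are averaged out one at a time. *)
Lemma expR_sqr_symmetric_le (r : seq I) (Y : T -> R) (b t : R) :
  bmeas Y -> 0 <= b -> 0 <= t ->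
  (forall i x, `|Y x - Y (s i x)| <= 2 * b) ->
  (forall x, Y (foldr s x r) = - Y x) ->
  16 * (size r)%:R * t * b ^+ 2 <= 1 ->
  \int[P]_x expR (t * Y x ^+ 2) <= expR (2 * (size r)%:R * t * b ^+ 2).
Proof.
move=> bY b0; elim: r Y t bY => [|j r IH] Y t bY t0 dY aY /=.
  move=> _; have Y0 x : Y x = 0 by have := aY x => /=; lra.
  under eq_Rintegral do rewrite Y0 expr0n mulr0 expR0.
  by rewrite bint_cst mulr0 !mul0r expR0.
rewrite -[(size r).+1]addn1 natrD; set k : R := (size r)%:R => kt.
have k0 : 0 <= k by exact: ler0n.
set tau := t * b ^+ 2.
have tau0 : 0 <= tau by rewrite mulr_ge0// sqr_ge0.
have ktau : 16 * (k + 1) * tau <= 1 by rewrite /tau; move: kt; lra.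
pose Z x := (Y x + Y (s j x)) / 2.
pose D x := (Y x - Y (s j x)) / 2.
have bYs : bmeas (fun x => Y (s j x)) by exact: bmeas_comp.
have bZ : bmeas Z.
  by apply: bmeasM; [exact: bmeasD|exact: bmeas_cst].
have Db x : D x ^+ 2 <= b ^+ 2.
  have Dn : `|D x| <= b.
    rewrite /D normrM (ger0_norm (_ : 0 <= 2^-1)) ?invr_ge0//.
    by rewrite ler_pdivrMr// mulrC; exact: dY.
  by rewrite -(real_normK (num_real (D x))) lerXn2r// nnegrE.
set t' := t * (1 + 8 * tau).
have t'0 : 0 <= t' by rewrite mulr_ge0//; lra.
have bE (F : T -> R) c : bmeas F -> bmeas (fun x => expR (c * F x ^+ 2)).
  move=> bF; apply: bmeas_expR; apply: bmeasM; first exact: bmeas_cst.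
  exact: bmeasX.
(* averaging over the first involution *)
have step : \int[P]_x expR (t * Y x ^+ 2) <=
    expR tau * \int[P]_x expR (t' * Z x ^+ 2).
  have -> : \int[P]_x expR (t * Y x ^+ 2) = \int[P]_x
      (2^-1 * (expR (t * Y x ^+ 2) + expR (t * Y (s j x) ^+ 2))).
    rewrite bintZ ?bintD; [|exact: bE|exact: bE|by apply: bmeasD; exact: bE].
    by rewrite (sP j (bE _ _ bY)); field.
  rewrite -bintZ; last exact: bE.
  apply: bint_le.
  - apply: bmeasM; first exact: bmeas_cst.
    by apply: bmeasD; exact: bE.
  - by apply: bmeasM; [exact: bmeas_cst|exact: bE].
  move=> x; have -> : Y x = Z x + D x by rewrite /Z /D; field.
  have -> : Y (s j x) = Z x - D x by rewrite /Z /D; field.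
  rewrite (_ : t * (Z x + D x) ^+ 2 = t * (Z x ^+ 2 + D x ^+ 2)
    + 2 * t * Z x * D x); last by ring.
  rewrite (_ : t * (Z x - D x) ^+ 2 = t * (Z x ^+ 2 + D x ^+ 2)
    + - (2 * t * Z x * D x)); last by ring.
  rewrite (expRD _ (2 * t * Z x * D x)) (expRD _ (- (2 * t * Z x * D x))).
  rewrite -mulrDr mulrCA mulrC [2^-1 * _]mulrC.
  apply: (@le_trans _ _ (expR (2 * (2 * t * Z x * D x) ^+ 2) *
     expR (t * (Z x ^+ 2 + D x ^+ 2)))).
    by rewrite ler_wpM2r ?expR_ge0// cosh_le_expR_sqr.
  rewrite -!expRD ler_expR.
  have e1 : t * D x ^+ 2 <= tau by rewrite ler_wpM2l.
  have e2 : 8 * t ^+ 2 * Z x ^+ 2 * D x ^+ 2 <= 8 * t ^+ 2 * Z x ^+ 2 * b ^+ 2.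
    by rewrite ler_wpM2l// mulr_ge0 ?sqr_ge0// mulr_ge0// sqr_ge0.
  have -> : t' * Z x ^+ 2 = t * Z x ^+ 2 + 8 * t ^+ 2 * Z x ^+ 2 * b ^+ 2.
    by rewrite /t' /tau; ring.
  have -> : 2 * (2 * t * Z x * D x) ^+ 2 = 8 * t ^+ 2 * Z x ^+ 2 * D x ^+ 2.
    by ring.
  lra.
have dZ i x : `|Z x - Z (s i x)| <= 2 * b.
  have -> : Z x - Z (s i x) =
      ((Y x - Y (s i x)) + (Y (s j x) - Y (s i (s j x)))) / 2.
    by rewrite /Z sC; field.
  rewrite normrM (ger0_norm (_ : 0 <= 2^-1)) ?invr_ge0// ler_pdivrMr//.
  by apply: le_trans (ler_normD _ _) _; have := dY i x;
    have := dY i (s j x); lra.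
have fs i x q : foldr s (s i x) q = s i (foldr s x q).
  by elim: q => //= k' q ->; rewrite sC.
have aZ x : Z (foldr s x r) = - Z x.
  have := aY x; have := aY (s j x); rewrite /= !fs sK /Z => -> ->.
  by field.
have k8 : 16 * k * tau <= 1 by nra.
have IHr := IH Z t' bZ t'0 dZ aZ.
apply: le_trans step _.
apply: (@le_trans _ _ (expR tau * expR (2 * k * t' * b ^+ 2))).
  rewrite ler_wpM2l ?expR_ge0// IHr//.
  have -> : 16 * k * t' * b ^+ 2 = 16 * k * tau * (1 + 8 * tau).
    by rewrite /t' /tau; ring.
  nra.
rewrite -expRD ler_expR.
have -> : 2 * k * t' * b ^+ 2 = 2 * k * tau * (1 + 8 * tau).
  by rewrite /t' /tau; ring.
have -> : 2 * (k + 1) * t * b ^+ 2 = 2 * (k + 1) * tau by rewrite /tau; ring.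
nra.
Qed.

End Symmetries.

(** * Samples with independent entries *)

(** [upd s i z] is the sample [s] with its [i]-th entry replaced by [z]. *)
Definition upd {E : Type} {n : nat} (s : n.-tuple E) (i : 'I_n) (z : E) :
  n.-tuple E := [tuple if k == i then z else tnth s k | k < n].

(** [mix B s s'] takes the entries indexed by [B] from [s'] and the others
from [s]. *)
Definition mix {E : Type} {n : nat} (B : pred 'I_n) (s s' : n.-tuple E) :
  n.-tuple E := [tuple if B k then tnth s' k else tnth s k | k < n].

(** The exchange of the [i]-th entries of two samples. *)
Definition swap_entry {E : Type} {n : nat} (i : 'I_n)
  (p : n.-tuple E * n.-tuple E) : n.-tuple E * n.-tuple E :=
  (upd p.1 i (tnth p.2 i), upd p.2 i (tnth p.1 i)).

(** [mu] is invariant under drawing any one entry anew from [Q]; this is how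
the law [mu] of an i.i.d. sample enters the argument. *)
Definition resampling {R : realType} {dE : measure_display}
  {E : measurableType dE} {n : nat} (mu : probability (n.-tuple E) R)
  (Q : probability E R) := forall (i : 'I_n) (phi : n.-tuple E -> R),
  bmeas phi -> \int[mu]_s phi s = \int[mu]_s \int[Q]_z phi (upd s i z).

Section SampleCombinatorics.
Context {E : Type} {n : nat}.
Implicit Types (s t : n.-tuple E) (i k : 'I_n).
Implicit Types (p : n.-tuple E * n.-tuple E).

Lemma tnth_upd s i z k : tnth (upd s i z) k = if k == i then z else tnth s k.
Proof. by rewrite tnth_mktuple. Qed.

Lemma tnth_mix B s t k :
  tnth (mix B s t) k = if B k then tnth t k else tnth s k.
Proof. by rewrite tnth_mktuple. Qed.

Lemma mix_updl (B : pred 'I_n) s t i z :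
  B i -> mix B (upd s i z) t = mix B s t.
Proof.
move=> Bi; apply: eq_from_tnth => k; rewrite !tnth_mix tnth_upd.
by case: ifP => // Bk; case: eqP => // ki; rewrite -ki Bk in Bi.
Qed.

Lemma mix_swap_entry B p i :
  mix B (swap_entry i p).1 (swap_entry i p).2 = upd (mix B p.1 p.2) i
    (if B i then tnth p.1 i else tnth p.2 i).
Proof.
apply: eq_from_tnth => k; rewrite tnth_mix tnth_upd tnth_mix !tnth_upd.
by case: (eqVneq k i) => [->|//]; case: (B i).
Qed.

Lemma swap_entryK i : involutive (@swap_entry E n i).
Proof.
move=> [s t]; rewrite /swap_entry /=; congr pair; apply: eq_from_tnth => k;
  by rewrite !tnth_upd eqxx; case: eqP => // ->.
Qed.

Lemma swap_entryC i j p :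
  swap_entry i (swap_entry j p) = swap_entry j (swap_entry i p).
Proof.
case: (eqVneq i j) => [->//|ij].
have ji : (j == i) = false by rewrite eq_sym (negbTE ij).
rewrite /swap_entry /=; congr pair; apply: eq_from_tnth => k;
  rewrite !tnth_upd (negbTE ij) ji;
  by case: (eqVneq k i) => // ->; rewrite (negbTE ij).
Qed.

Lemma foldr_swap_entry (r : seq 'I_n) (p : n.-tuple E * n.-tuple E) :
  uniq r -> foldr (@swap_entry E n) p r =
  (mix (mem r) p.1 p.2, mix (mem r) p.2 p.1).
Proof.
elim: r => [_|i r IH] /=.
  by case: p => s t; congr pair; apply: eq_from_tnth => k; rewrite tnth_mix.
move=> /andP[ir ur]; rewrite IH// /swap_entry /=.
congr pair; apply: eq_from_tnth => k; rewrite tnth_upd !tnth_mix /= in_cons;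
  case: eqP => //= ->; by rewrite (negbTE ir).
Qed.

(** Exchanging the entries in [r] exchanges the two mixtures that differ
only on [r]. *)
Lemma mix_foldr_swap (B C : pred 'I_n) (r : seq 'I_n) p : uniq r ->
  (forall k, C k = B k || (k \in r)) -> (forall k, B k -> k \notin r) ->
  let q := foldr (@swap_entry E n) p r in
  mix B q.1 q.2 = mix C p.1 p.2 /\ mix C q.1 q.2 = mix B p.1 p.2.
Proof.
move=> ur CE dB /=; rewrite foldr_swap_entry//=.
split; apply: eq_from_tnth => k; rewrite !tnth_mix /= CE;
  by have := dB k; case: (B k) => [/(_ isT)/negbTE ->|_] //=; case: (k \in r).
Qed.

End SampleCombinatorics.

Section SampleMeasurability.
Context {dT dE : measure_display} {T : measurableType dT}
  {E : measurableType dE} {n : nat}.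

Lemma measurable_tnth_comp (s : T -> n.-tuple E) k :
  measurable_fun [set: T] s -> measurable_fun [set: T] (fun x => tnth (s x) k).
Proof.
move=> ms.
by apply: (measurableT_comp (f := fun u : n.-tuple E => tnth u k)) => //;
  exact: measurable_tnth.
Qed.

Lemma measurable_upd (s : T -> n.-tuple E) i (z : T -> E) :
  measurable_fun [set: T] s -> measurable_fun [set: T] z ->
  measurable_fun [set: T] (fun x => upd (s x) i (z x)).
Proof.
move=> ms mz; apply/measurable_fun_tnthP => k.
rewrite (_ : _ \o _ = fun x => if k == i then z x else tnth (s x) k).
  by case: (k == i) => //; exact: measurable_tnth_comp.
by apply/funext => x /=; rewrite tnth_upd.
Qed.

Lemma measurable_mix (B : pred 'I_n) (s t : T -> n.-tuple E) :
  measurable_fun [set: T] s -> measurable_fun [set: T] t ->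
  measurable_fun [set: T] (fun x => mix B (s x) (t x)).
Proof.
move=> ms mt; apply/measurable_fun_tnthP => k.
rewrite (_ : _ \o _ = fun x => if B k then tnth (t x) k else tnth (s x) k).
  by case: (B k) => //; exact: measurable_tnth_comp.
by apply/funext => x /=; rewrite tnth_mix.
Qed.

End SampleMeasurability.

Lemma measurable_swap_entry {dE : measure_display} {E : measurableType dE}
  {n : nat} (i : 'I_n) :
  measurable_fun [set: n.-tuple E * n.-tuple E] (@swap_entry E n i).
Proof.
apply: measurable_fun_pair; apply: measurable_upd => //;
  exact: measurable_tnth_comp.
Qed.

Section Resampling.
Context {R : realType} {dE : measure_display} {E : measurableType dE}
  {n : nat}.
Variables (mu : probability (n.-tuple E) R) (Q : probability E R).
Hypothesis rs : resampling mu Q.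
Let TT : measurableType _ := n.-tuple E.

(** Both [i]-th entries of two independent samples can be drawn anew. *)
Lemma bint_resample2 (i : 'I_n) (f : TT * TT -> R) : bmeas f ->
  \int[(mu \x mu)%E]_p f p =
  \int[mu]_s \int[mu]_t \int[Q]_z \int[Q]_y f (upd s i z, upd t i y).
Proof.
move=> bf; rewrite (bint_prod mu mu bf).
transitivity (\int[mu]_t \int[Q]_y \int[mu]_s f (s, upd t i y)).
  rewrite bint_exchange// (rs i)//.
  exact: (bmeas_bint mu (bmeas_swap bf)).
transitivity (\int[mu]_t \int[Q]_y \int[mu]_s \int[Q]_z
    f (upd s i z, upd t i y)).
  apply: eq_Rintegral => t _; apply: eq_Rintegral => y _.
  by rewrite (rs i)//; exact: (bmeas_pairr _ bf).
pose g (q : TT * TT * (E * E)) := f (upd q.1.1 i q.2.1, upd q.1.2 i q.2.2).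
have bg : bmeas g.
  apply: bmeas_comp bf; apply: measurable_fun_pair;
    by apply: measurable_upd; apply: measurableT_comp.
have bgq (h : TT * TT * (E * E) -> R) q : bmeas h -> bmeas (fun w => h (q, w)).
  exact: bmeas_pairl.
transitivity (\int[mu]_t \int[mu]_s \int[Q]_y \int[Q]_z g ((s, t), (z, y))).
  apply: eq_Rintegral => t _.
  have bg' : bmeas (fun w : E * TT => \int[Q]_z g ((w.2, t), (z, w.1))).
    apply: (@bmeas_bint _ _ _ _ _ Q
      (fun v : E * TT * E => g ((v.1.2, t), (v.2, v.1.1)))).
    apply: bmeas_comp bg; apply: measurable_fun_pair.
      apply: measurable_fun_pair => //; apply: measurableT_comp => //.
    apply: measurable_fun_pair => //; apply: measurableT_comp => //.
  exact: (bint_exchange Q mu bg').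
rewrite [RHS](_ : _ = \int[mu]_s \int[mu]_t \int[Q]_y \int[Q]_z
    g ((s, t), (z, y))); last first.
  apply: eq_Rintegral => s _; apply: eq_Rintegral => t _.
  have bg' : bmeas (fun w : E * E => g ((s, t), w)) by exact: bmeas_pairl.
  exact: (bint_exchange Q Q bg').
apply: (bint_exchange mu mu (f := fun w : TT * TT =>
  \int[Q]_y \int[Q]_z g ((w.2, w.1), (z, y)))).
apply: (@bmeas_bint _ _ _ _ _ Q (fun v : TT * TT * E =>
  \int[Q]_z g ((v.1.2, v.1.1), (z, v.2)))).
apply: (@bmeas_bint _ _ _ _ _ Q (fun v : TT * TT * E * E =>
  g ((v.1.1.2, v.1.1.1), (v.2, v.1.2)))).
apply: bmeas_comp bg; apply: measurable_fun_pair; apply: measurable_fun_pair => //;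
  repeat (apply: measurableT_comp => //).
Qed.

(** Two independent samples are exchangeable entry by entry. *)
Lemma bint_swap_entry (i : 'I_n) (f : TT * TT -> R) : bmeas f ->
  \int[(mu \x mu)%E]_p f (swap_entry i p) = \int[(mu \x mu)%E]_p f p.
Proof.
move=> bf.
have bfs : bmeas (fun p => f (swap_entry i p)).
  exact: bmeas_comp (measurable_swap_entry i) bf.
rewrite (bint_resample2 i bf) (bint_resample2 i bfs).
apply: eq_Rintegral => s _; apply: eq_Rintegral => t _.
have updK (u : TT) z y : upd (upd u i z) i y = upd u i y.
  by apply: eq_from_tnth => k; rewrite !tnth_upd; case: eqP.
rewrite /swap_entry /=.
under eq_Rintegral do under eq_Rintegral do rewrite !updK !tnth_upd eqxx.
apply: (@bint_exchange _ _ _ _ _ Q Q (fun w : E * E => f (upd s i w.2, upd t i w.1))).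
apply: bmeas_comp bf; apply: measurable_fun_pair; exact: measurable_upd.
Qed.

(** The entries indexed by [r] are integrated out one at a time. *)
Lemma expR_centred_sum_le (r : seq 'I_n) (h : TT * E -> R) (phi : TT -> R) :
  uniq r -> bmeas h -> bmeas phi -> (forall s, 0 <= phi s) ->
  (forall s i z y, i \in r -> h (upd s i z, y) = h (s, y)) ->
  (forall s i z, i \in r -> phi (upd s i z) = phi s) ->
  \int[mu]_s (phi s *
    expR (\sum_(i <- r) (\int[Q]_z h (s, z) - h (s, tnth s i)))) <=
  \int[mu]_s (phi s * (\int[Q]_z expR (8 * h (s, z) ^+ 2)) ^+ size r).
Proof.
move=> + bh; elim: r phi => [|i r IH] phi /=.
  move=> _ bphi _ _ _; under eq_Rintegral do rewrite big_nil expR0.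
  by under [leRHS]eq_Rintegral do rewrite expr0.
move=> /andP[ir ur] bphi phi0 hi phii.
have bhb : bmeas (fun s => \int[Q]_z h (s, z)) by exact: bmeas_bint.
have b8 : bmeas (fun w : TT * E => expR (8 * h w ^+ 2)).
  apply: bmeas_expR; apply: bmeasM; first exact: bmeas_cst.
  exact: bmeasX.
pose W s := \int[Q]_z expR (8 * h (s, z) ^+ 2).
have bW : bmeas W by exact: (bmeas_bint Q b8).
have W0 s : 0 <= W s by apply: Rintegral_ge0 => z _; exact: expR_ge0.
have bht k : bmeas (fun s : TT => h (s, tnth s k)).
  apply: bmeas_comp bh; apply: measurable_fun_pair => //.
  exact: measurable_tnth.
have bd k : bmeas (fun s => \int[Q]_z h (s, z) - h (s, tnth s k)).
  exact: bmeasB.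
pose V s := expR (\sum_(k <- r) (\int[Q]_z h (s, z) - h (s, tnth s k))).
have bV : bmeas V by apply: bmeas_expR; exact: bmeas_sum.
have hb s z : \int[Q]_y h (upd s i z, y) = \int[Q]_y h (s, y).
  by apply: eq_Rintegral => y _; rewrite hi// mem_head.
rewrite (rs i); last first.
  by apply: bmeasM => //; apply: bmeas_expR; exact: bmeas_sum.
have E1 s : \int[Q]_z (phi (upd s i z) * expR (\sum_(k <- i :: r)
      (\int[Q]_y h (upd s i z, y) - h (upd s i z, tnth (upd s i z) k)))) =
    phi s * V s * \int[Q]_z expR (\int[Q]_y h (s, y) - h (s, z)).
  rewrite -bintZ; last first.
    apply: bmeas_expR; apply: bmeasB; first exact: bmeas_cst.
    exact: bmeas_pairl.
  apply: eq_Rintegral => z _; rewrite phii ?mem_head// big_cons expRD.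
  rewrite hb hi ?mem_head// tnth_upd eqxx -mulrA; congr (_ * _).
  rewrite mulrC; congr (_ * _); congr expR.
  apply: eq_big_seq => k kr; rewrite hi ?mem_head// tnth_upd.
  by case: eqP => // ki; rewrite -ki kr in ir.
under eq_Rintegral do rewrite E1.
apply: (@le_trans _ _ (\int[mu]_s ((phi s * W s) * V s))).
  apply: bint_le.
  - apply: bmeasM; first exact: bmeasM.
    apply: (@bmeas_bint _ _ _ _ _ Q
      (fun w : TT * E => expR (\int[Q]_y h (w.1, y) - h w))).
    apply: bmeas_expR; apply: bmeasB => //.
    exact: (bmeas_comp measurable_fst bhb).
  - by apply: bmeasM => //; exact: bmeasM.
  move=> s; rewrite -mulrA [leRHS]mulrAC -[leRHS]mulrA ler_wpM2l// ler_wpM2l//.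
    exact: expR_ge0.
  by apply: expR_centred_le; exact: bmeas_pairl.
under [leRHS]eq_Rintegral do rewrite exprS mulrA.
apply: IH => //.
- exact: bmeasM.
- by move=> s; rewrite mulr_ge0.
- by move=> s k z y kr; rewrite hi// in_cons kr orbT.
- move=> s k z kr; rewrite phii ?in_cons ?kr ?orbT//; congr (_ * _).
  by apply: eq_Rintegral => y _; rewrite hi// in_cons kr orbT.
Qed.

(** The same without weight, the power of the mean being estimated by a mean
of powers. *)
Lemma expR_centred_sum_le1 (r : seq 'I_n) (m : nat) (h : TT * E -> R) :
  uniq r -> (size r <= m)%N -> bmeas h ->
  (forall s i z y, i \in r -> h (upd s i z, y) = h (s, y)) ->
  \int[mu]_s expR (\sum_(i <- r) (\int[Q]_z h (s, z) - h (s, tnth s i))) <=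
  \int[mu]_s \int[Q]_z expR (m%:R * (8 * h (s, z) ^+ 2)).
Proof.
move=> ur rm bh hi.
have b8 : bmeas (fun w : TT * E => expR (8 * h w ^+ 2)).
  apply: bmeas_expR; apply: bmeasM; first exact: bmeas_cst.
  exact: bmeasX.
have bm8 : bmeas (fun w : TT * E => expR (m%:R * (8 * h w ^+ 2))).
  apply: bmeas_expR; apply: bmeasM; first exact: bmeas_cst.
  by apply: bmeasM; [exact: bmeas_cst|exact: bmeasX].
have := @expR_centred_sum_le r h (fun=> 1) ur bh (bmeas_cst 1) (fun=> ler01) hi.
move=> /(_ (fun _ _ _ _ => erefl)).
under eq_Rintegral do rewrite mul1r.
move=> /le_trans; apply.
apply: bint_le.
- by apply: bmeasM; [exact: bmeas_cst|apply: bmeasX; exact: (bmeas_bint Q b8)].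
- exact: (bmeas_bint Q bm8).
move=> s; rewrite mul1r.
have bs8 : bmeas (fun z => expR (8 * h (s, z) ^+ 2)) by exact: (bmeas_pairl s b8).
apply: (@le_trans _ _ ((\int[Q]_z expR (8 * h (s, z) ^+ 2)) ^+ m)).
  apply: ler_weXn2l => //; apply: cst_le_bint => // z.
  by rewrite -[leLHS]expR0 ler_expR mulr_ge0// sqr_ge0.
apply: le_trans (exprn_bint_le Q m bs8 (fun=> expR_ge0 _)) _.
apply: bint_le; [exact: bmeasX|exact: (bmeas_pairl s bm8)|] => z.
by rewrite (expRM_natl m).
Qed.

(** Two mixtures of a sample with an independent copy that differ on [r]
only give values of [F] at a subgaussian distance, of variance proportional
to [size r]. *)
Lemma expR_sqr_mix_le (F : TT -> R) (B C : pred 'I_n) (r : seq 'I_n)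
    (b t : R) :
  bmeas F -> (forall s i z, `|F s - F (upd s i z)| <= b) ->
  uniq r -> (forall k, C k = B k || (k \in r)) ->
  (forall k, B k -> k \notin r) ->
  0 <= b -> 0 <= t -> 16 * (size r)%:R * t * b ^+ 2 <= 1 ->
  \int[(mu \x mu)%E]_p
    expR (t * (F (mix B p.1 p.2) - F (mix C p.1 p.2)) ^+ 2) <=
  expR (2 * (size r)%:R * t * b ^+ 2).
Proof.
move=> bF dF ur CE dB b0 t0 tb.
have bm (A : pred 'I_n) : bmeas (fun p : TT * TT => F (mix A p.1 p.2)).
  by apply: bmeas_comp bF; exact: measurable_mix.
apply: (@expR_sqr_symmetric_le _ _ _ (mu \x mu)%E _ (@swap_entry E n) _ _ _ _
  r (fun p => F (mix B p.1 p.2) - F (mix C p.1 p.2))) => //.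
- exact: measurable_swap_entry.
- exact: swap_entryK.
- exact: swap_entryC.
- exact: bint_swap_entry.
- exact: (bmeasB (bm B) (bm C)).
- move=> i p; rewrite !mix_swap_entry.
  have := dF (mix B p.1 p.2) i (if B i then tnth p.1 i else tnth p.2 i).
  have := dF (mix C p.1 p.2) i (if C i then tnth p.1 i else tnth p.2 i).
  by rewrite !ler_norml => /andP[? ?] /andP[? ?]; apply/andP; split; lra.
- move=> p; have [/= -> ->] := mix_foldr_swap p ur CE dB.
  by rewrite opprB.
Qed.

End Resampling.

(** * Uniformly stable algorithms *)

(** The [c]-th dyadic block of length [2 ^ l]. *)
Definition blk {n : nat} (l c : nat) : pred 'I_n :=
  fun j => c == (j %/ 2 ^ l)%N.

(** The block that forms, with block [c], a block of the next level. *)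
Definition sibling (c : nat) : nat := if odd c then c.-1 else c.+1.

Lemma size_enum_blk n l c : (size (enum (@blk n l c)) <= 2 ^ l)%N.
Proof.
rewrite -(size_map val) -(size_iota (c * 2 ^ l) (2 ^ l)).
apply: uniq_leq_size; first by rewrite (map_inj_uniq val_inj) enum_uniq.
move=> _ /mapP[j jc ->]; move: jc; rewrite mem_enum mem_iota => /eqP ->.
by rewrite leq_divM/= -mulSnr ltn_ceil// expn_gt0.
Qed.

Lemma blkS n l c (k : 'I_n) :
  blk l.+1 c./2 k = blk l c k || blk l (sibling c) k.
Proof.
rewrite /blk /sibling expnSr divnMA divn2.
by move: (k %/ 2 ^ l)%N => q; case: ifP => oc; lia.
Qed.

Lemma sibling_neq c : sibling c != c.
Proof. by rewrite /sibling; case: ifP => oc; lia. Qed.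

Lemma expR_inv8_le2 {R : realType} : expR (8^-1) <= 2 :> R.
Proof.
have := expR_ge1Dx (- 8^-1 : R); have := expRxMexpNx_1 (8^-1 : R).
by have := expR_gt0 (8^-1 : R); nra.
Qed.

Lemma expR_inv16_le {R : realType} : expR (16^-1) <= 16 / 15 :> R.
Proof.
have := expR_ge1Dx (- 16^-1 : R); have := expRxMexpNx_1 (16^-1 : R).
by have := expR_gt0 (16^-1 : R); nra.
Qed.

Section Stability.
Context {R : realType} {dE : measure_display} {E : measurableType dE}
  {n : nat}.
Variables (mu : probability (n.-tuple E) R) (Q : probability E R).
Hypothesis rs : resampling mu Q.
Let TT : measurableType _ := n.-tuple E.

Variables (a : TT * E -> R) (b : R).
Hypothesis ba : bmeas a.
Hypothesis b0 : 0 < b.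
Hypothesis stable : forall s i z e, `|a (s, e) - a (upd s i z, e)| <= b.

(* the mean loss of the output of the algorithm on the sample [s] *)
Let abar (s : TT) := \int[Q]_z a (s, z).
Let dev (s : TT) z := abar s - a (s, z).

Let babar : bmeas abar. Proof. exact: bmeas_bint. Qed.

Let bdev (B : pred 'I_n) i :
  bmeas (fun p : TT * TT => dev (mix B p.1 p.2) (tnth p.1 i)).
Proof.
apply: bmeasB; first by apply: bmeas_comp babar; exact: measurable_mix.
apply: bmeas_comp ba; apply: measurable_fun_pair; first exact: measurable_mix.
exact: measurable_tnth_comp.
Qed.

(** One block [rb] of observations, of length at most [m], with the blocks
[B] and [C] of exchanged entries before and after adding the sibling [r]. *)
Lemma block_moment_le (rb r : seq 'I_n) (B C : pred 'I_n) (m : nat) (k : R) :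
  uniq rb -> (size rb <= m)%N -> (forall i, i \in rb -> B i) ->
  uniq r -> (size r <= m)%N ->
  (forall i, C i = B i || (i \in r)) -> (forall i, B i -> i \notin r) ->
  0 <= k -> 12 * (k * m%:R * b) <= 1 ->
  \int[(mu \x mu)%E]_p expR (k * \sum_(i <- rb)
    (dev (mix B p.1 p.2) (tnth p.1 i) - dev (mix C p.1 p.2) (tnth p.1 i))) <= 2.
Proof.
move=> urb srb rbB ur sr CE dB k0 kmb.
have Ci i : i \in rb -> C i by move=> /rbB Bi; rewrite CE Bi.
pose h (q : TT * TT * E) :=
  k * (a (mix B q.1.1 q.1.2, q.2) - a (mix C q.1.1 q.1.2, q.2)).
have bamix (A : pred 'I_n) :
    bmeas (fun q : TT * TT * E => a (mix A q.1.1 q.1.2, q.2)).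
  apply: bmeas_comp ba; apply: measurable_fun_pair => //.
  by apply: measurable_mix; exact: measurableT_comp.
have bh : bmeas h.
  by apply: bmeasM; [exact: bmeas_cst|exact: (bmeasB (bamix B) (bamix C))].
pose G (q : TT * TT * E) := expR (m%:R * (8 * h q ^+ 2)).
have bG : bmeas G.
  apply: bmeas_expR; apply: bmeasM; first exact: bmeas_cst.
  by apply: bmeasM; [exact: bmeas_cst|exact: bmeasX].
pose H (p : TT * TT) := expR (k * \sum_(i <- rb)
  (dev (mix B p.1 p.2) (tnth p.1 i) - dev (mix C p.1 p.2) (tnth p.1 i))).
have bH : bmeas H.
  apply: bmeas_expR; apply: bmeasM; first exact: bmeas_cst.
  by apply: bmeas_sum => i; exact: (bmeasB (bdev B i) (bdev C i)).
have HE p : H p = expR (\sum_(i <- rb)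
    (\int[Q]_z h (p, z) - h (p, tnth p.1 i))).
  congr expR; rewrite mulr_sumr; apply: eq_bigr => i _.
  have ba1 (A : pred 'I_n) : bmeas (fun z => a (mix A p.1 p.2, z)).
    exact: bmeas_pairl.
  rewrite bintZ ?bintB//; last exact: bmeasB.
  by rewrite /h /dev /abar /=; ring.
rewrite (bint_prod mu mu bH) (bint_exchange mu mu bH).
apply: (@le_trans _ _ (\int[mu]_t \int[mu]_s \int[Q]_z G ((s, t), z))).
  have bGi : bmeas (fun p : TT * TT => \int[Q]_z G (p, z)) by exact: bmeas_bint.
  apply: bint_le.
  - exact: (bmeas_bint mu (bmeas_swap bH)).
  - exact: (bmeas_bint mu (bmeas_swap bGi)).
  move=> t; under eq_Rintegral do rewrite HE.
  apply: (expR_centred_sum_le1 rs (h := fun w => h ((w.1, t), w.2))) => //.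
    apply: bmeas_comp bh; apply: measurable_fun_pair => //.
    exact: measurable_fun_pair.
  by move=> s i z y irb; rewrite /h /= !mix_updl ?Ci ?rbB.
rewrite (bint_exchange mu mu (f := fun w : TT * TT =>
  \int[Q]_z G ((w.2, w.1), z))); last first.
  exact: (bmeas_swap (bmeas_bint Q bG)).
rewrite -(bint_prod mu mu (bmeas_bint Q bG)) (bint_exchange _ Q bG).
apply: bint_le_cst.
  exact: (bmeas_bint (mu \x mu)%E (bmeas_swap bG)).
move=> z; set t : R := 8 * m%:R * k ^+ 2.
have m0 : 0 <= m%:R :> R by exact: ler0n.
have rm : (size r)%:R <= m%:R :> R by rewrite ler_nat.
have tb2 : (size r)%:R * t * b ^+ 2 <= 8 * (k * m%:R * b) ^+ 2.
  have -> : 8 * (k * m%:R * b) ^+ 2 = m%:R * (8 * m%:R * k ^+ 2 * b ^+ 2).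
    by ring.
  rewrite -mulrA ler_wpM2r//.
  by rewrite mulr_ge0 ?sqr_ge0// mulr_ge0 ?sqr_ge0// mulr_ge0.
have kmb0 : 0 <= k * m%:R * b by rewrite !mulr_ge0// ltW.
have kmb2 : 144 * (k * m%:R * b) ^+ 2 <= 1 by nra.
have := @expR_sqr_mix_le _ _ _ _ mu Q rs (fun s => a (s, z)) B C r b t
  (bmeas_pairr z ba) (fun s i y => stable s i y z) ur CE dB (ltW b0).
have t0 : 0 <= t by rewrite mulr_ge0 ?sqr_ge0// mulr_ge0.
move=> /(_ t0) /= I1; apply: (@le_trans _ _ (expR 8^-1)); last first.
  exact: expR_inv8_le2.
apply: le_trans (_ : expR (2 * (size r)%:R * t * b ^+ 2) <= _); last first.
  by rewrite ler_expR; move: tb2 kmb2; lra.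
apply: le_trans (I1 _); last by move: tb2 kmb2; lra.
rewrite le_eqVlt; apply/orP; left; apply/eqP; apply: eq_Rintegral => p _.
by rewrite /G /h /t; congr expR; ring.
Qed.

(* the deviations when the dyadic block of length [2 ^ l] around each
observation is taken from the second sample *)
Let U l (p : TT * TT) := \sum_(i < n)
  dev (mix (blk l (i %/ 2 ^ l)) p.1 p.2) (tnth p.1 i).

Let bU l : bmeas (U l).
Proof. by apply: bmeas_sum => i; exact: bdev. Qed.

(** One level of the dyadic decomposition: the blocks of the level are
dependent, so their moments are combined by convexity. *)
Lemma level_moment_le (L l : nat) (k : R) : (n <= 2 ^ L)%N -> (l < L)%N ->
  0 <= k -> 12 * (k * (2 ^ L)%:R * b) <= 1 ->
  \int[(mu \x mu)%E]_p expR (k * (U l p - U l.+1 p)) <= 2.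
Proof.
move=> nL lL k0 kb; set K := (2 ^ (L - l))%N.
have K0 : 0 < K%:R :> R by rewrite ltr0n expn_gt0.
pose V c (p : TT * TT) := \sum_(i <- enum (@blk n l c))
  (dev (mix (blk l c) p.1 p.2) (tnth p.1 i)
   - dev (mix (blk l.+1 c./2) p.1 p.2) (tnth p.1 i)).
have bV c : bmeas (V c).
  by apply: bmeas_sum => i; exact: (bmeasB (bdev _ i) (bdev _ i)).
have UV p : U l p - U l.+1 p = \sum_(c <- iota 0 K) V c p.
  rewrite /U -sumrB.
  under [RHS]eq_bigr do rewrite /V big_enum.
  rewrite (exchange_big_dep xpredT)//=; apply: eq_bigr => i _.
  rewrite -big_filter (filter_pred1_uniq (iota_uniq _ _)).
    by rewrite big_seq1 expnSr divnMA divn2.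
  rewrite mem_iota/= add0n ltn_divLR ?expn_gt0// -expnD subnK ?(ltnW lL)//.
  exact: leq_trans nL.
apply: (@le_trans _ _ (\int[(mu \x mu)%E]_p
    (K%:R^-1 * \sum_(c <- iota 0 K) expR (K%:R * k * V c p)))).
  apply: bint_le.
  - by apply: bmeas_expR; apply: bmeasM; [exact: bmeas_cst|exact: (bmeasB (bU _) (bU _))].
  - apply: bmeasM; first exact: bmeas_cst.
    apply: bmeas_sum => c; apply: bmeas_expR.
    by apply: bmeasM; [exact: bmeas_cst|exact: bV].
  move=> p; rewrite UV.
  have := @expR_mean_le R _ (iota 0 K) (fun c => K%:R * k * V c p).
  rewrite size_iota => /(_ _) I1; apply: le_trans (I1 _).
    by rewrite -mulr_sumr !mulrA mulVf ?gt_eqF// mul1r.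
  by rewrite expn_gt0.
have bVe c : bmeas (fun p => expR (K%:R * k * V c p)).
  by apply: bmeas_expR; apply: bmeasM; [exact: bmeas_cst|exact: bV].
rewrite bintZ; last exact: bmeas_sum.
rewrite bint_sum// mulrC ler_pdivrMr//.
have -> : 2 * K%:R = \sum_(c <- iota 0 K) (2 : R).
  by rewrite big_const_seq count_predT size_iota iter_addr_0 mulr_natr.
apply: ler_sum => c _.
apply: (@block_moment_le _ (enum (@blk n l (sibling c))) _ _ (2 ^ l)).
- exact: enum_uniq.
- exact: size_enum_blk.
- by move=> i; rewrite mem_enum.
- exact: enum_uniq.
- exact: size_enum_blk.
- by move=> i; rewrite mem_enum blkS.
- move=> i; rewrite mem_enum /blk unfold_in /= => /eqP <-.
  exact: sibling_neq.
- by rewrite mulr_ge0// ltW.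
- have -> : K%:R * k * (2 ^ l)%:R * b = k * (2 ^ L)%:R * b.
    rewrite -[in RHS](subnK (ltnW lL)) expnD natrM -/K; ring.
  by [].
Qed.

Variables (V lam : R) (L : nat).
Hypothesis lam0 : 0 <= lam.
Hypothesis erm : forall s, \sum_(i < n) a (s, tnth s i) <= n%:R * b.
Hypothesis bernstein : forall s e, a (s, e) ^+ 2 <= V * abar s.
Hypothesis V0 : 0 < V.
Hypothesis Vlam : 64 * V * lam <= 1.
Hypothesis L0 : (0 < L)%N.
Hypothesis nL : (n <= 2 ^ L)%N.
Hypothesis Ln : (2 ^ L <= 2 * n)%N.
Hypothesis blam : 48 * L%:R * n%:R * b * lam <= 1.

Let abar_ge0 s : 0 <= abar s.
Proof.
rewrite -(pmulr_rge0 _ V0).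
by have := bernstein s point; apply: le_trans; exact: sqr_ge0.
Qed.

Let Psi := \int[mu]_s expR (lam * n%:R * abar s).

Let bPsi : bmeas (fun s => expR (lam * n%:R * abar s)).
Proof.
by apply: bmeas_expR; apply: bmeasM; [exact: bmeas_cst|exact: babar].
Qed.

(** The top level, where the algorithm sees only the independent copy: the
variance bound returns a small multiple of the moment being estimated. *)
Lemma top_level_moment_le :
  \int[(mu \x mu)%E]_p expR (2 * lam * U L p) <= 2^-1 + 2^-1 * Psi.
Proof.
have UE p : 2 * lam * U L p = \sum_(i <- enum 'I_n)
    (\int[Q]_z (2 * lam * a (p.2, z)) - 2 * lam * a (p.2, tnth p.1 i)).
  rewrite /U big_enum/= mulr_sumr; apply: eq_bigr => i _.
  rewrite (_ : mix _ _ _ = p.2); last first.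
    apply: eq_from_tnth => k; rewrite tnth_mix /blk.
    by rewrite !divn_small ?eqxx//; exact: leq_trans nL.
  by rewrite bintZ ?mulrBr//; exact: bmeas_pairl.
have bUL : bmeas (fun p => expR (2 * lam * U L p)).
  by apply: bmeas_expR; apply: bmeasM; [exact: bmeas_cst|exact: bU].
rewrite (bint_prod mu mu bUL) (bint_exchange mu mu bUL) -bintZ// -[X in _ <= X + _](bint_cst mu).
rewrite -bintD; [|exact: bmeas_cst|by apply: bmeasM => //; exact: bmeas_cst].
apply: bint_le.
- exact: (bmeas_bint mu (bmeas_swap bUL)).
- apply: bmeasD; first exact: bmeas_cst.
  by apply: bmeasM => //; exact: bmeas_cst.
move=> t; under eq_Rintegral do rewrite UE.
have bat : bmeas (fun w : TT * E => 2 * lam * a (t, w.2)).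
  apply: bmeasM; first exact: bmeas_cst.
  by apply: bmeas_comp ba; exact: measurable_fun_pair.
have sz : (size (enum 'I_n) <= n)%N by rewrite size_enum_ord.
have := @expR_centred_sum_le1 _ _ _ _ mu Q rs (enum 'I_n) n _ (enum_uniq _)
  sz bat (fun _ _ _ _ _ => erefl).
move=> /le_trans; apply; rewrite /=.
have y0 : 0 <= lam * n%:R * abar t by rewrite !mulr_ge0.
apply: bint_le_cst.
  apply: (bmeas_bint Q (f := fun w : TT * E =>
    expR (n%:R * (8 * (2 * lam * a (t, w.2)) ^+ 2)))).
  apply: bmeas_expR; apply: bmeasM; first exact: bmeas_cst.
  by apply: bmeasM; [exact: bmeas_cst|exact: bmeasX].
move=> s; apply: bint_le_cst.
  apply: bmeas_expR; apply: bmeasM; first exact: bmeas_cst.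
  apply: bmeasM; first exact: bmeas_cst.
  by apply: bmeasX; apply: bmeasM; [exact: bmeas_cst|exact: bmeas_pairl].
move=> z; apply: (@le_trans _ _ (expR (2^-1 * (lam * n%:R * abar t)))).
  rewrite ler_expR.
  have -> : n%:R * (8 * (2 * lam * a (t, z)) ^+ 2) =
    32 * lam ^+ 2 * n%:R * a (t, z) ^+ 2 by ring.
  apply: (@le_trans _ _ (32 * lam ^+ 2 * n%:R * (V * abar t))).
    apply: ler_wpM2l; last exact: bernstein.
    by rewrite !mulr_ge0 ?sqr_ge0.
  have -> : 32 * lam ^+ 2 * n%:R * (V * abar t) =
    64 * V * lam * (2^-1 * (lam * n%:R * abar t)) by field.
  by rewrite ler_piMl// mulr_ge0.
move: y0; set y := _ * abar t => y0.
have e2 : expR y = expR (2^-1 * y) ^+ 2.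
  by rewrite -(expRM_natl 2) mulrA divff ?mul1r.
by rewrite e2; have := sqr_ge0 (expR (2^-1 * y) - 1); rewrite sqrrB; lra.
Qed.

(** The sum of the deviations of one sample telescopes along the dyadic
levels, from the block of length one to the whole sample. *)
Lemma excess_le_levels p : n%:R * abar p.1 <=
  3 * (n%:R * b) + \sum_(l <- iota 0 L) (U l p - U l.+1 p) + U L p.
Proof.
have -> : \sum_(l <- iota 0 L) (U l p - U l.+1 p) = U 0%N p - U L p.
  rewrite -(opprB (U L p)) -(telescope_sumr (U ^~ p) (leq0n L)) /index_iota subn0.
  by rewrite -sumrN; apply: eq_bigr => l _; rewrite opprB.
have -> : n%:R * abar p.1 = \sum_(i < n) abar p.1.
  by rewrite sumr_const card_ord mulr_natl.
have E1 : \sum_(i < n) abar p.1 =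
    \sum_(i < n) dev p.1 (tnth p.1 i) + \sum_(i < n) a (p.1, tnth p.1 i).
  by rewrite -big_split; apply: eq_bigr => i _; rewrite /dev /= subrK.
have E2 : \sum_(i < n) dev p.1 (tnth p.1 i) <= 2 * (n%:R * b) + U 0%N p.
  have -> : 2 * (n%:R * b) = \sum_(i < n) (2 * b).
    by rewrite sumr_const card_ord -mulr_natl; ring.
  rewrite -big_split; apply: ler_sum => i _ /=.
  have -> : mix (blk 0 (i %/ 2 ^ 0)) p.1 p.2 = upd p.1 i (tnth p.2 i).
    apply: eq_from_tnth => k; rewrite tnth_mix tnth_upd /blk !divn1.
    rewrite -(inj_eq val_inj k i) eq_sym /=.
    by case: eqP => // /val_inj ->.
  have st z : a (p.1, z) <= a (upd p.1 i (tnth p.2 i), z) + b /\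
      a (upd p.1 i (tnth p.2 i), z) <= a (p.1, z) + b.
    by have := stable p.1 i (tnth p.2 i) z; rewrite ler_norml => /andP[? ?];
      split; lra.
  have : abar p.1 <= abar (upd p.1 i (tnth p.2 i)) + b.
    rewrite -[X in _ <= _ + X](bint_cst Q b) -bintD; last 2 first.
    - exact: bmeas_pairl.
    - exact: bmeas_cst.
    apply: bint_le; first exact: bmeas_pairl.
      by apply: bmeasD; [exact: bmeas_pairl|exact: bmeas_cst].
    by move=> z; have [] := st z.
  by rewrite /dev; have [_] := st (tnth p.1 i); lra.
by rewrite E1; have := erm p.1; lra.
Qed.

(** Exponential moment of the excess risk of a uniformly stable algorithm
whose losses satisfy a Bernstein condition.  Half of the weight is given to
the top level and the other half is shared equally by the other levels. *)
Lemma stable_excess_moment_le : Psi <= 2.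
Proof.
have arith (w x y : R) : y <= 16 / 15 * (2^-1 * w + 2^-1 * x) -> w <= 2 ->
  x <= 2^-1 + 2^-1 * y -> y <= 2 by lra.
pose W (p : TT * TT) := L%:R^-1 *
  \sum_(l <- iota 0 L) expR (2 * L%:R * lam * (U l p - U l.+1 p)).
pose X (p : TT * TT) := expR (2 * lam * U L p).
have LR : 0 < L%:R :> R by rewrite ltr0n.
have L1 : 1 <= L%:R :> R by rewrite ler1n.
have bWl l : bmeas (fun p => expR (2 * L%:R * lam * (U l p - U l.+1 p))).
  by apply: bmeas_expR; apply: bmeasM; [exact: bmeas_cst|exact: (bmeasB (bU _) (bU _))].
have bW : bmeas W by apply: bmeasM; [exact: bmeas_cst|exact: bmeas_sum].
have bX : bmeas X.
  by apply: bmeas_expR; apply: bmeasM; [exact: bmeas_cst|exact: bU].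
have IW : \int[(mu \x mu)%E]_p W p <= 2.
  rewrite bintZ; last exact: bmeas_sum.
  rewrite bint_sum// mulrC ler_pdivrMr//.
  rewrite [leRHS](_ : _ = \sum_(l <- iota 0 L) (2 : R)); last first.
    by rewrite big_const_seq count_predT size_iota iter_addr_0 mulr_natr.
  rewrite big_seq [leRHS]big_seq; apply: ler_sum => l.
  rewrite mem_iota/= add0n => lL; apply: (level_moment_le nL lL).
    by rewrite !mulr_ge0.
  apply: le_trans blam.
  have -> : 48 * L%:R * n%:R * b * lam = 12 * (2 * L%:R * lam * (2 * n%:R) * b).
    by ring.
  rewrite ler_pM2l// ler_wpM2r ?(ltW b0)// ler_wpM2l ?mulr_ge0//.
  by rewrite -natrM ler_nat.
have nb : 3 * (n%:R * b) * lam <= 16^-1.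
  have z0 : 0 <= n%:R * b * lam by rewrite !mulr_ge0// ltW.
  have : L%:R * (n%:R * b * lam) >= n%:R * b * lam by rewrite ler_peMl.
  by move: blam; rewrite (_ : 48 * L%:R * n%:R * b * lam =
    48 * (L%:R * (n%:R * b * lam))); [lra|ring].
have P1 : Psi <= 16 / 15 * (2^-1 * \int[(mu \x mu)%E]_p W p +
    2^-1 * \int[(mu \x mu)%E]_p X p).
  have -> : Psi = \int[(mu \x mu)%E]_p expR (lam * n%:R * abar p.1).
    rewrite bint_prod/=; last exact: (bmeas_comp measurable_fst bPsi).
    by apply: eq_Rintegral => s _; rewrite bint_cst.
  have bW2 : bmeas (fun p => 2^-1 * W p).
    by apply: bmeasM => //; exact: bmeas_cst.
  have bX2 : bmeas (fun p => 2^-1 * X p).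
    by apply: bmeasM => //; exact: bmeas_cst.
  rewrite -!bintZ// -bintD// -bintZ; last exact: bmeasD.
  apply: bint_le; first exact: (bmeas_comp measurable_fst bPsi).
    by apply: bmeasM; [exact: bmeas_cst|exact: bmeasD].
  move=> p; set S := \sum_(l <- iota 0 L) (U l p - U l.+1 p).
  have J1 : expR (2 * lam * S) <= W p.
    have := @expR_mean_le R _ (iota 0 L)
      (fun l => 2 * L%:R * lam * (U l p - U l.+1 p)).
    rewrite size_iota => /(_ L0); apply: le_trans.
    rewrite -mulr_sumr -/S ler_expR le_eqVlt; apply/orP; left; apply/eqP.
    by field; rewrite gt_eqF.
  have J2 : expR (lam * S + lam * U L p) <= 2^-1 * W p + 2^-1 * X p.
    have E2 (y z : R) : expR (y + z) <= 2^-1 * expR (2 * y) + 2^-1 * expR (2 * z).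
      rewrite !(expRM_natl 2) expRD.
      have := sqr_ge0 (expR y - expR z); rewrite sqrrB; lra.
    apply: le_trans (E2 _ _) _; apply: lerD.
      by rewrite mulrA ler_wpM2l.
    by rewrite (mulrA 2 lam).
  apply: (@le_trans _ _ (expR (3 * (n%:R * b) * lam) *
      expR (lam * S + lam * U L p))).
    rewrite -expRD ler_expR -mulrA.
    have := ler_wpM2l lam0 (excess_le_levels p); rewrite -/S.
    by rewrite !mulrDr [lam * (3 * _)]mulrC addrA.
  apply: ler_pM => //; rewrite ?expR_ge0//.
  by apply: le_trans expR_inv16_le; rewrite ler_expR.
exact: arith P1 IW top_level_moment_le.
Qed.

End Stability.

(** * The law of an i.i.d. sample *)

Lemma bint_distribution {R : realType} {d1 d2 : measure_display}
  {T1 : measurableType d1} {T2 : measurableType d2} (P : probability T1 R)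
  (X : {mfun T1 >-> T2}) (phi : T2 -> R) : bmeas phi ->
  \int[distribution P X]_y phi y = \int[P]_x phi (X x).
Proof.
move=> bphi; rewrite /Rintegral integral_distribution//.
  by apply/measurable_EFinP; case: bphi.
have bX : bmeas (fun x => phi (X x)) by apply: bmeas_comp bphi.
exact: (bmeas_integrable P bX).
Qed.

(** The rectangle with the sides [B k]. *)
Definition rect {E : Type} {n : nat} (B : 'I_n -> set E) : set (n.-tuple E) :=
  [set s | forall k, B k (tnth s k)].

(** The rectangles with measurable sides: a pi-system that generates the
sigma-algebra of the tuples. *)
Definition rects {dE : measure_display} (E : measurableType dE) (n : nat) :
  set (set (n.-tuple E)) :=
  [set A | exists2 B : 'I_n -> set E, (forall k, measurable (B k)) & A = rect B].

Section Rectangles.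
Context {dE : measure_display} {E : measurableType dE} {n : nat}.

Lemma measurable_rect (B : 'I_n -> set E) : (forall k, measurable (B k)) ->
  measurable (rect B).
Proof.
move=> mB; rewrite (_ : rect B = \bigcap_(k in [set: 'I_n])
    ((fun s : n.-tuple E => tnth s k) @^-1` B k)); last first.
  by apply/seteqP; split=> s /= sB k => [_|]; [exact: sB|exact: sB].
apply: fin_bigcap_measurable => // k _; rewrite -[X in measurable X]setTI.
exact: measurable_tnth.
Qed.

Lemma rects_measurableE : @measurable _ (n.-tuple E) = <<s @rects _ E n >>.
Proof.
apply/seteqP; split; last first.
  apply: smallest_sub; first exact: sigma_algebra_measurable.
  by move=> _ [B mB ->]; exact: measurable_rect.
apply: smallest_sub; first exact: smallest_sigma_algebra.
rewrite -bigcup_seq => A [i _ [B mB <-]]; rewrite setTI.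
apply: sub_sigma_algebra; exists (fun k => if k == i then B else setT).
  by move=> k; case: ifP.
apply/seteqP; split=> s /=.
  by move=> sB k; case: eqP => // ->.
by move=> /(_ i); rewrite eqxx.
Qed.

Lemma setI_closed_rects : setI_closed (@rects _ E n).
Proof.
move=> _ _ [B mB ->] [C mC ->]; exists (fun k => B k `&` C k).
  by move=> k; exact: measurableI.
apply/seteqP; split=> s /=; first by move=> [sB sC] k; split.
by move=> sBC; split=> k; have [] := sBC k.
Qed.

End Rectangles.

Section IidSample.
Local Open Scope ereal_scope.
Context {R : realType} {dO dE : measure_display} {Omega : measurableType dO}
  {E : measurableType dE} {n : nat}.
Variables (P : probability Omega R) (xi : {RV P >-> E})
  (xis : 'I_n -> {RV P >-> E}).
Hypothesis iid : iid_copies xi xis.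
Let Q := distribution P xi.

Lemma measurable_sample : measurable_fun [set: Omega] (sample xis).
Proof.
apply/measurable_fun_tnthP => k.
rewrite (_ : _ \o _ = xis k) //.
by apply/funext => w /=; rewrite tnth_mktuple.
Qed.

Lemma sample_rect (B : 'I_n -> set E) : (forall k, measurable (B k)) ->
  P (sample xis @^-1` rect B) = \prod_(k < n) Q (B k).
Proof.
move=> mB; case: iid => ind same.
have := ind [set: 'I_n]%SET B (fun k _ => mB k).
rewrite (_ : \bigcap_(k in _) _ = sample xis @^-1` rect B); last first.
  apply/seteqP; split=> w /=.
    by move=> wB k; rewrite tnth_mktuple; apply: wB; rewrite /= inE.
  by move=> wB k _; have := wB k; rewrite tnth_mktuple.
move=> ->; apply: eq_big => [k|k _]; first by rewrite inE.
exact: (same k (B k) (mB k)).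
Qed.

Variable S : {mfun Omega >-> n.-tuple E}.
Hypothesis SE : forall w, S w = sample xis w.

Lemma resampling_sample : resampling (distribution P S) Q.
Proof.
move=> i phi bphi; set mu := distribution P S.
have muE (B : 'I_n -> set E) : (forall k, measurable (B k)) ->
    mu (rect B) = \prod_(k < n) Q (B k).
  move=> mB; rewrite -sample_rect// /mu /distribution /pushforward.
  by congr (P _); apply/seteqP; split=> w /=; rewrite SE.
have mu_upd : measurable_fun [set: n.-tuple E * E] (fun p => upd p.1 i p.2).
  exact: measurable_upd.
pose h : {mfun (n.-tuple E * E)%type >-> n.-tuple E} :=
  HB.pack (fun p : n.-tuple E * E => upd p.1 i p.2)
    (isMeasurableFun.Build _ _ _ _ _ mu_upd).
pose nu := distribution (mu \x Q) h.
have munu A : measurable A -> mu A = nu A.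
  apply: (measure_unique (@rects _ E n) (fun=> setT)) => //.
  - exact: rects_measurableE.
  - exact: setI_closed_rects.
  - move=> _; exists (fun=> setT) => //.
    by apply/seteqP; split.
  - by apply/seteqP; split=> // s _; exists 0%N.
  - move=> _ [B mB ->]; apply: (etrans (muE B mB)); apply: esym.
    transitivity ((mu \x Q) (h @^-1` rect B)); first by [].
    pose B' k := if k == i then setT else B k.
    have mB' k : measurable (B' k) by rewrite /B'; case: ifP.
    rewrite (_ : h @^-1` rect B = rect B' `*` B i); last first.
      apply/seteqP; split=> -[s z] /=.
        move=> sB; split; last by have := sB i; rewrite tnth_upd eqxx.
        move=> k; rewrite /B'; case: ifPn => // ki.
        by have := sB k; rewrite tnth_upd (negbTE ki).
      move=> [sB zB] k; rewrite tnth_upd; case: eqP => [->//|/eqP ki].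
      by have := sB k; rewrite /B' (negbTE ki).
    rewrite product_measure1E//; last exact: measurable_rect.
    rewrite [RHS](bigD1 i)//= muleC; congr (_ * _).
    transitivity (\prod_(k < n) Q (B' k)); first exact: muE.
    rewrite [LHS](bigD1 i)//= {1}/B' eqxx.
    transitivity (1 * \prod_(k < n | k != i) Q (B k)); last by rewrite mul1e.
    congr (_ * _); first exact: (probability_setT Q).
    by apply: eq_bigr => k ki; rewrite /B' (negbTE ki).
  - by move=> _; exact: le_lt_trans (probability_le1 mu measurableT) (ltry 1).
transitivity (\int[nu]_s phi s)%R.
  rewrite /Rintegral; congr fine.
  by apply: eq_measure_integral => A mA _; exact: munu.
rewrite bint_distribution//.
by rewrite (bint_prod mu Q (f := fun p => phi (h p)))//; exact: bmeas_comp bphi.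
Qed.

End IidSample.

(** * Norms and countable dense subsets *)

Section LpNorm.
Context {R : realType} {d : nat}.
Implicit Types (p : \bar R) (x y : 'rV[R]_d).

Lemma lp_norm_ge0 p x : 0 <= lp_norm p x.
Proof.
case: p => [r| |] //=; first exact: powR_ge0.
by elim/big_rec: _ => // i u _ u0; rewrite le_max u0 orbT.
Qed.

Lemma lp_normN p x : lp_norm p (- x) = lp_norm p x.
Proof.
have nE i : `|(- x) 0 i| = `|x 0 i| by rewrite mxE normrN.
case: p => [r| |]; last by [].
  by congr (_ `^ _); apply: eq_bigr => i _; rewrite nE.
by apply: eq_bigr => i _; rewrite nE.
Qed.

Lemma lp_norm_sym p x y : lp_norm p (x - y) = lp_norm p (y - x).
Proof. by rewrite -lp_normN opprB. Qed.

Lemma lp_normZ p (c : R) x : (1 <= p)%E -> 0 <= c ->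
  lp_norm p (c *: x) = c * lp_norm p x.
Proof.
case: p => [r| |] //=; rewrite ?lee_fin => p1 c0; last first.
  rewrite (big_morph (fun u => c * u) (id1 := 0) (op1 := Num.max)).
  - by apply: eq_bigr => i _; rewrite mxE normrM ger0_norm.
  - by move=> u v; rewrite maxr_pMr.
  - by rewrite mulr0.
under eq_bigr do rewrite mxE normrM (ger0_norm c0) powRM//.
rewrite -mulr_sumr powRM ?powR_ge0//; last first.
  by apply: sumr_ge0 => i _; exact: powR_ge0.
by rewrite -powRrM divff ?powRr1// gt_eqF// (lt_le_trans ltr01).
Qed.

(** The norm is continuous at the origin for the coordinatewise topology. *)
Lemma lp_norm_small p (e : R) : (1 <= d)%N -> (1 <= p)%E -> 0 < e ->
  exists2 r : R, 0 < r &
  forall x, (forall i, `|x 0 i| <= r) -> lp_norm p x <= e.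
Proof.
move=> d1 + e0; case: p => [r| |] //=; last first.
  move=> _; exists e => // x xe; elim/big_rec: _ => [|i u _ ue]; first exact: ltW.
  by rewrite ge_max xe.
rewrite lee_fin => r1.
have r0 : 0 < r by exact: lt_le_trans r1.
have d0 : 0 < d%:R :> R by rewrite ltr0n.
exists (e * d%:R^-1 `^ r^-1) => [|x xe].
  by rewrite mulr_gt0// powR_gt0// invr_gt0.
rewrite -[leRHS](powRr1 (ltW e0)) -(divff (lt0r_neq0 r0)) powRrM.
apply: ge0_ler_powR; rewrite ?nnegrE ?powR_ge0 ?invr_ge0 ?(ltW r0)//.
  by apply: sumr_ge0 => i _; exact: powR_ge0.
have -> : e `^ r = \sum_(i < d) (e `^ r * d%:R^-1).
  by rewrite sumr_const card_ord -[RHS]mulr_natr mulfVK ?gt_eqF.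
apply: ler_sum => i _; apply: (@le_trans _ _ ((e * d%:R^-1 `^ r^-1) `^ r)).
  by apply: ge0_ler_powR; rewrite ?nnegrE ?mulr_ge0 ?powR_ge0 ?(ltW r0) ?(ltW e0).
by rewrite powRM ?powR_ge0 ?(ltW e0)// -powRrM mulVf ?gt_eqF// powRr1.
Qed.

(** A nonempty set of vectors has a countable dense subset: one of its points
near each rational vector at each scale, when there is any. *)
Lemma dense_sequence (X : set 'rV[R]_d) : X !=set0 ->
  exists2 u : nat -> 'rV[R]_d, (forall k, X (u k)) &
  forall y (r : R), X y -> 0 < r -> exists k, forall i, `|y 0 i - u k 0 i| < r.
Proof.
move=> [x0 Xx0].
pose near_pt (q : {ffun 'I_d -> rat} * nat) y :=
  X y /\ forall i, `|y 0 i - ratr (q.1 i)| < q.2.+1%:R^-1.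
have pick q : exists y, X y /\ ((exists z, near_pt q z) -> near_pt q y).
  have [[z zq]|nz] := pselect (exists z, near_pt q z).
    by exists z; split; [case: zq|].
  by exists x0; split.
have [g gP] := choice pick.
exists (fun k => if unpickle k is Some q then g q else x0).
  by move=> k; case: unpickle => // q; have [] := gP q.
move=> y r Xy r0.
pose m := Num.truncn (2 / r).
have mr : 2 * m.+1%:R^-1 < r.
  rewrite ltr_pdivrMr ?ltr0n// mulrC -ltr_pdivrMr//.
  by rewrite truncnS_gt.
have m0 : 0 < m.+1%:R^-1 :> R by rewrite invr_gt0 ltr0n.
have exq i : exists q : rat, `|y 0 i - ratr q| < m.+1%:R^-1.
  move: m0; move: (m.+1%:R^-1) (y 0 i) => a z a0.
  have [q] : exists q, ratr q \in `](z - a), (z + a)[.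
    by apply: rat_in_itvoo; lra.
  rewrite in_itv/= => /andP[q1 q2]; exists q; rewrite ltr_norml.
  by apply/andP; split; lra.
have [q qP] := choice exq.
pose Q : {ffun 'I_d -> rat} * nat := ([ffun i => q i], m).
have yQ : near_pt Q y by split=> // i; rewrite ffunE.
have [_ [|_ gQ]] := gP Q; first by exists y.
exists (pickle Q) => i; rewrite pickleK; apply: lt_trans mr.
have := gQ i; case: yQ => _ /(_ i) /=; rewrite ffunE.
move: (m.+1%:R^-1 : R) => c; rewrite !ltr_norml.
by move=> /andP[? ?] /andP[? ?]; apply/andP; split; lra.
Qed.

Lemma lp_dense_sequence p (X : set 'rV[R]_d) : (1 <= d)%N -> (1 <= p)%E ->
  X !=set0 -> exists2 u : nat -> 'rV[R]_d, (forall k, X (u k)) &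
  forall y (e : R), X y -> 0 < e -> exists k, lp_norm p (y - u k) < e.
Proof.
move=> d1 p1 X0; have [u Xu du] := dense_sequence X0; exists u => // y e Xy e0.
have e20 : 0 < e / 2 by rewrite divr_gt0.
have [r r0 re] := lp_norm_small d1 p1 e20.
have [k kr] := du y r Xy r0.
exists k; apply: le_lt_trans (re _ _) _; last by lra.
by move=> i; rewrite !mxE ltW.
Qed.

End LpNorm.

(** * Measurable selections *)

Lemma measurable_first_index {d : measure_display} {T : measurableType d}
  (A : nat -> set T) : (forall k, measurable (A k)) ->
  (forall s, exists k, A k s) ->
  exists2 k : T -> nat, (forall s, A (k s) s) &
    forall j, measurable [set s | k s = j].
Proof.
move=> mA exA; have exA' s : exists k, `[< A k s >].
  by have [k Ak] := exA s; exists k; apply/asboolP.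
exists (fun s => ex_minn (exA' s)).
  by move=> s; case: ex_minnP => k /asboolP.
move=> j; rewrite (_ : [set s | _] = A j `\` \bigcup_(i in `I_j) A i).
  by apply: measurableD => //; apply: bigcup_measurable => i _.
apply/seteqP; split=> s /=.
  case: ex_minnP => k /asboolP Ak kmin <-; split=> // -[i /= ik /asboolP Ai].
  by have := kmin i Ai; rewrite leqNgt ik.
move=> [Aj nA]; case: ex_minnP => k /asboolP Ak kmin.
apply/eqP; rewrite eqn_leq kmin ?andTb; last exact/asboolP.
by rewrite leqNgt; apply/negP => kj; apply: nA; exists k.
Qed.

Lemma measurable_countable_choice {d1 d2 d3 : measure_display}
  {T1 : measurableType d1} {T2 : measurableType d2} {T3 : measurableType d3}
  (g : nat -> T2 -> T3) (k : T1 -> nat) :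
  (forall j, measurable [set s | k s = j]) ->
  (forall j, measurable_fun [set: T2] (g j)) ->
  measurable_fun [set: T1 * T2] (fun q => g (k q.1) q.2).
Proof.
move=> mk mg _ Y mY; rewrite setTI.
rewrite (_ : _ @^-1` Y = \bigcup_j ([set s | k s = j] `*` (g j @^-1` Y))).
  apply: bigcupT_measurable => j; apply: measurableX => //.
  by rewrite -[X in measurable X]setTI; exact: mg.
apply/seteqP; split=> [[s e] /= Ye|[s e] [j _ [/= <-]]//].
by exists (k s).
Qed.

(** A Caratheodory function, evaluated at a Borel measurable choice of its
first argument. *)
Lemma measurable_lipschitz_comp {R : realType} {d : nat} {d1 d2 : measure_display}
  {T1 : measurableType d1} {T2 : measurableType d2} (p : \bar R) (M : R)
  (X : set 'rV[R]_d) (g : 'rV[R]_d -> T2 -> R) (h : T1 -> 'rV[R]_d) :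
  (1 <= d)%N -> (1 <= p)%E -> 0 < M ->
  (forall x, X x -> measurable_fun [set: T2] (g x)) ->
  (forall x y e, X x -> X y -> `|g y e - g x e| <= M * lp_norm p (y - x)) ->
  borel_measurable h -> (forall s, X (h s)) ->
  measurable_fun [set: T1 * T2] (fun q => g (h q.1) q.2).
Proof.
move=> d1' p1 M0 mg gL mh Xh.
have [u Xu du] : exists2 u : nat -> 'rV[R]_d, (forall k, X (u k)) &
    forall y (r : R), X y -> 0 < r -> exists k, forall i, `|y 0 i - u k 0 i| < r.
  by apply: dense_sequence; exists (h point).
have rm m : exists r : R, 0 < r /\
    forall x : 'rV[R]_d, (forall i, `|x 0 i| <= r) -> lp_norm p x <= m.+1%:R^-1.
  have m0 : 0 < m.+1%:R^-1 :> R by rewrite invr_gt0 ltr0n.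
  by have [r r0 rP] := lp_norm_small d1' p1 m0; exists r.
have [r rP] := choice rm.
(* approximation of [h] by functions with countably many values *)
have km m : exists k : T1 -> nat, (forall s, ball (u (k s)) (r m) (h s)) /\
    forall j, measurable [set s | k s = j].
  have [||k kP mk] := @measurable_first_index _ T1
      (fun j => h @^-1` (ball (u j) (r m))°).
  - move=> j; rewrite -[X in measurable X]setTI; apply: mh => //.
    by apply: sub_sigma_algebra; exact: open_interior.
  - move=> s; have [r0 _] := rP m.
    have [k kr] := du (h s) (r m) (Xh s) r0.
    exists k => /=; rewrite /interior /=; apply: open_nbhs_nbhs; split.
      exact: ball_open.
    by split=> // i j; rewrite !ord1 /ball /= distrC; exact: kr.
  by exists k; split=> // s; have := kP s; exact: interior_subset.
have [k kP] := choice km.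
apply: (@measurable_fun_cvg _ _ _ _ (fun m q => g (u (k m q.1)) q.2)).
  move=> m; have [_ mk] := kP m.
  by apply: (measurable_countable_choice (g := fun j => g (u j))) => // j; exact: mg.
move=> [s e] _ /=.
have bound m : `|g (h s) e - g (u (k m s)) e| <= M * m.+1%:R^-1.
  apply: le_trans (gL _ _ _ (Xu _) (Xh _)) _; rewrite ler_pM2l//.
  have [_ rm'] := rP m; apply: rm' => i; rewrite !mxE distrC ltW//.
  by have [/(_ s) [_ /(_ 0 i)]] := kP m.
apply/cvgrPdist_le => eps eps0; near=> m.
apply: le_trans (bound m) _.
rewrite -ler_pdivlMl// mulrC; near: m.
have e0 : 0 < eps / M by rewrite divr_gt0.
by apply: filterS (near_infty_natSinv_lt (PosNum e0)) => j /= /ltW.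
Unshelve. all: by end_near.
Qed.

(** * Strong convexity *)

(** Strong convexity at midpoints, the form in which it passes to averages
and expectations without any reference to gradients. *)
Definition strongly_midconvex {R : realType} {d : nat} (p : \bar R) (mu : R)
  (X : set 'rV[R]_d) (G : 'rV[R]_d -> R) :=
  forall x y, X x -> X y -> G (2^-1 *: (x + y)) <=
    2^-1 * G x + 2^-1 * G y + - (mu / 8 * lp_norm p (y - x) ^+ 2).

Section StrongConvexity.
Context {R : realType} {d : nat}.
Variables (p : \bar R) (mu M : R) (X : set 'rV[R]_d).
Hypothesis p1 : (1 <= p)%E.
Hypothesis mu0 : 0 < mu.
Hypothesis M0 : 0 < M.
Hypothesis convX : convex_set X.
Implicit Types (G : 'rV[R]_d -> R) (x y : 'rV[R]_d).

Lemma convex_set_midpoint x y : X x -> X y -> X (2^-1 *: (x + y)).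
Proof.
move=> Xx Xy.
have h0 : 0 <= 2^-1 :> R by rewrite invr_ge0.
have h1 : 2^-1 <= 1 :> R by rewrite invf_le1// ler1n.
have := @convX x y (Itv01 h0 h1).
rewrite !inE => /(_ Xx Xy).
have -> : 2^-1 *: (x + y) = 2^-1 *: x + (1 - 2^-1) *: y.
  by rewrite scalerDr; congr (_ + _ *: _); field.
by [].
Qed.

Lemma dotpDr (g u v : 'rV[R]_d) : dotp g (u + v) = dotp g u + dotp g v.
Proof.
by rewrite /dotp -big_split; apply: eq_bigr => i _; rewrite mxE mulrDr.
Qed.

Lemma strongly_midconvex_gradient G :
  (forall x y, X x -> X y -> G y >= G x + dotp (gradient G x) (y - x)
    + mu / 2 * lp_norm p (y - x) ^+ 2) ->
  strongly_midconvex p mu X G.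
Proof.
move=> sc x y Xx Xy; set m := 2^-1 *: (x + y).
have Xm : X m by exact: convex_set_midpoint.
have hx : x - m = 2^-1 *: (x - y).
  by apply/rowP => i; rewrite !mxE; field.
have hy : y - m = 2^-1 *: (y - x).
  by apply/rowP => i; rewrite !mxE; field.
have := sc m x Xm Xx; have := sc m y Xm Xy.
have : dotp (gradient G m) (x - m) + dotp (gradient G m) (y - m) = 0.
  rewrite -dotpDr hx hy -scalerDr (_ : x - y + (y - x) = 0); last first.
    by rewrite addrA subrK subrr.
  by rewrite scaler0 /dotp big1// => i _; rewrite [X in _ * X]mxE mulr0.
rewrite hx hy !lp_normZ ?invr_ge0// (lp_norm_sym _ x y).
move: (dotp _ _) (dotp _ _) (lp_norm _ _) => u v r.
by rewrite !exprMn; move: (r ^+ 2) => r2; nra.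
Qed.

(** Two points with small excess over a lower bound are close. *)
Lemma strongly_midconvex_dist G c x y : strongly_midconvex p mu X G ->
  (forall z, X z -> c <= G z) -> X x -> X y ->
  lp_norm p (y - x) ^+ 2 <= 4 / mu * (G x + G y - 2 * c).
Proof.
move=> sG Gc Xx Xy; have := sG x y Xx Xy.
have := Gc _ (convex_set_midpoint Xx Xy).
move: (G (2^-1 *: _)) (G x) (G y) (_ ^+ 2) => gm gx gy r2 h1 h2.
rewrite mulrAC ler_pdivlMr//; nra.
Qed.

Lemma strongly_midconvex_diam G x y : strongly_midconvex p mu X G ->
  (forall x y, X x -> X y -> `|G y - G x| <= M * lp_norm p (y - x)) ->
  X x -> X y -> lp_norm p (y - x) <= 4 * M / mu.
Proof.
move=> sG lG Xx Xy; have := sG x y Xx Xy.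
have Xm := convex_set_midpoint Xx Xy.
have := lG _ _ Xm Xx; have := lG _ _ Xm Xy.
have -> : y - 2^-1 *: (x + y) = 2^-1 *: (y - x).
  by apply/rowP => i; rewrite !mxE; field.
have -> : x - 2^-1 *: (x + y) = 2^-1 *: (x - y).
  by apply/rowP => i; rewrite !mxE; field.
rewrite !lp_normZ ?invr_ge0// (lp_norm_sym _ x y).
have := lp_norm_ge0 p (y - x).
move: (G (2^-1 *: _)) (G x) (G y) (lp_norm _ _) => gm gx gy r r0.
rewrite !ler_norml => /andP[_ h1] /andP[_ h2] h3.
rewrite ler_pdivlMr//.
have h4 : mu * (r * r) <= 4 * M * r by rewrite -expr2; lra.
case: (ltgtP 0 r) r0 => // [r0 _|<- _]; last by rewrite mul0r mulr_ge0// ltW.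
by rewrite -(ler_pM2r r0); lra.
Qed.

End StrongConvexity.

Section Risks.
Context {R : realType} {d : nat} {dO dE : measure_display}
  {Omega : measurableType dO} {E : measurableType dE}.
Variables (P : probability Omega R) (xi : {RV P >-> E}).
Variables (p : \bar R) (mu M : R) (X : set 'rV[R]_d) (f : 'rV[R]_d -> E -> R).
Hypothesis p1 : (1 <= p)%E.
Hypothesis convX : convex_set X.
Hypothesis fint :
  forall x, X x -> P.-integrable [set: Omega] (fun w => (f x (xi w))%:E).
Hypothesis fconv : forall e, strongly_midconvex p mu X (f ^~ e).

Lemma riskE x : risk f xi x = \int[P]_w f x (xi w).
Proof. by rewrite /risk /Rintegral unlock. Qed.

Lemma risk_le_comb x y z (a b c : R) : X x -> X y -> X z ->
  (forall e, f x e <= a * f y e + b * f z e + c) ->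
  risk f xi x <= a * risk f xi y + b * risk f xi z + c.
Proof.
move=> Xx Xy Xz fle; rewrite !riskE.
have iZ k v : X v -> P.-integrable setT (EFin \o (fun w => k * f v (xi w))).
  move=> Xv; rewrite (_ : _ \o _ = fun w => (k%:E * (f v (xi w))%:E)%E).
    by apply: integrableZl => //; exact: fint.
  by apply/funext => w /=; rewrite EFinM.
have iC : P.-integrable setT (EFin \o (fun=> c : R) : Omega -> \bar R).
  exact: (bmeas_integrable P (bmeas_cst c)).
have iD (g h : Omega -> R) : P.-integrable setT (EFin \o g) ->
    P.-integrable setT (EFin \o h) ->
    P.-integrable setT (EFin \o (fun w => g w + h w)).
  move=> ig ih; rewrite (_ : _ \o _ = ((EFin \o g) \+ (EFin \o h))%E)//.
  exact: integrableD.
rewrite -(RintegralZl a measurableT (fint Xy)).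
rewrite -(RintegralZl b measurableT (fint Xz)) -(bint_cst P c).
have iyz := iD _ _ (iZ a y Xy) (iZ b z Xz).
rewrite -(RintegralD measurableT (iZ a y Xy) (iZ b z Xz)).
rewrite -(RintegralD measurableT iyz iC).
exact: (le_Rintegral measurableT (fint Xx) (iD _ _ iyz iC)).
Qed.

Lemma strongly_midconvex_risk : strongly_midconvex p mu X (risk f xi).
Proof.
move=> x y Xx Xy; apply: risk_le_comb => // [|e]; last exact: fconv.
exact: convex_set_midpoint.
Qed.

Lemma risk_lipschitz :
  (forall x y e, X x -> X y -> `|f y e - f x e| <= M * lp_norm p (y - x)) ->
  forall x y, X x -> X y -> `|risk f xi y - risk f xi x| <= M * lp_norm p (y - x).
Proof.
move=> fL x y Xx Xy.
have L (u v : 'rV[R]_d) : X u -> X v ->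
    risk f xi u <= risk f xi v + M * lp_norm p (u - v).
  move=> Xu Xv.
  have := @risk_le_comb u v v 1 0 (M * lp_norm p (u - v)) Xu Xv Xv.
  rewrite mul1r mul0r addr0; apply => e; rewrite mul1r mul0r addr0.
  by have := fL v u e Xv Xu; rewrite ler_norml => /andP[_]; lra.
have := L y x Xy Xx; have := L x y Xx Xy; rewrite (lp_norm_sym _ x y).
by rewrite ler_norml => ? ?; apply/andP; split; lra.
Qed.

Variable N : nat.
Hypothesis N0 : (0 < N)%N.

Lemma strongly_midconvex_empirical (s : N.-tuple E) :
  strongly_midconvex p mu X (empirical_risk f s).
Proof.
move=> x y Xx Xy; have NR : 0 < N%:R :> R by rewrite ltr0n.
rewrite /empirical_risk; set c := - _.
have -> : 2^-1 * (N%:R^-1 * \sum_(k < N) f x (tnth s k)) +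
    2^-1 * (N%:R^-1 * \sum_(k < N) f y (tnth s k)) + c =
    N%:R^-1 * \sum_(k < N) (2^-1 * f x (tnth s k) + 2^-1 * f y (tnth s k) + c).
  rewrite !big_split/= -!mulr_sumr sumr_const card_ord -[c *+ N]mulr_natl.
  by field; rewrite gt_eqF.
rewrite ler_pM2l ?invr_gt0//.
by apply: ler_sum => k _; exact: fconv.
Qed.

End Risks.

(** * The sample size *)

Section SampleSize.
Context {R : realType}.

Lemma ln2_ge_half : 2^-1 <= ln 2 :> R.
Proof.
rewrite -ler_expR lnK ?posrE//.
have := expR_ge1Dx (- 2^-1 : R); have := expRxMexpNx_1 (2^-1 : R).
by have := expR_gt0 (2^-1 : R); nra.
Qed.

Lemma ln_le_id (x : R) : 0 < x -> ln x <= x.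
Proof. by move=> x0; rewrite ltW// ln_sublinear. Qed.

(** Inversion of [n >= q * b], with [b] at least the logarithm of [q], into
[n >= q * ln n], up to the constants. *)
Lemma ln_inversion (c q b n : R) : 1 <= c -> 0 < q -> 1 <= b -> q <= expR b ->
  32 * c ^+ 2 * q * b <= n -> c * q * ln (2 * n) <= n.
Proof.
move=> c1 q0 b1 qb nb; have c0 : 0 < c by lra.
have b0 : 0 < b by lra.
have k0 : 0 < 32 * c ^+ 2 * q * b by rewrite !mulr_gt0// exprn_gt0.
set k := 32 * c ^+ 2 * q * b in nb k0.
have [s s1 nE] : exists2 s, 1 <= s & n = k * s.
  exists (n / k); first by rewrite ler_pdivlMr// mul1r.
  by rewrite mulrC mulfVK// gt_eqF.
have s0 : 0 < s by lra.
have lnE : ln (2 * n) = ln (8 * c) + ln (8 * c) + ln q + ln b + ln s.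
  have -> : 2 * n = 8 * c * (8 * c) * q * b * s by rewrite nE /k; ring.
  have c80 : 0 < 8 * c by rewrite mulr_gt0.
  by move: (8 * c) c80 => w w0; rewrite !lnM ?posrE ?mulr_gt0.
have l1 : ln (8 * c) <= 8 * c by apply: ln_le_id; rewrite mulr_gt0.
have l2 : ln q <= b by rewrite -[leRHS]expRK ler_ln ?posrE ?expR_gt0.
have l3 := ln_le_id b0; have l4 := ln_le_id s0.
have : ln (2 * n) <= 32 * c * b * s.
  rewrite lnE; have bs : 1 <= b * s by nra.
  have h1 : c <= c * (b * s) by rewrite ler_peMr// ltW.
  have h2 : b <= b * s by rewrite ler_peMr// ltW.
  have h3 : s <= b * s by rewrite ler_peMl// ltW.
  have h4 : b * s <= c * (b * s) by rewrite ler_peMl//; lra.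
  by rewrite -mulrA -mulrA; lra.
move=> lb; rewrite [leRHS]nE.
have -> : k * s = c * q * (32 * c * b * s) by rewrite /k; ring.
by rewrite ler_pM2l// mulr_gt0.
Qed.

Lemma ln_max1_ge1 (t : R) : 1 <= ln_max1 t.
Proof. by rewrite /ln_max1 le_max lexx orbT. Qed.

Lemma le_expR_ln_max1 (t : R) : 0 < t -> t <= expR (ln_max1 t).
Proof.
by move=> t0; rewrite -[leLHS]lnK ?posrE// ler_expR /ln_max1 le_max lexx.
Qed.

(** The number of levels satisfies [L <= 2 * ln (2 * N)], and
[ln (4 / sigma) <= 5 * ln_max1 (1 / sigma)], so that [ln_inversion] is used
with [c = 864 * 2 * 5 = 8640]. *)
Lemma sample_size (a sigma : R) (N : nat) : 0 < a -> 0 < sigma < 1 ->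
  N%:R >= 32 * 8640 ^+ 2 * a
    * (ln_max1 a + ln_max1 (ln (1 / sigma))) * ln_max1 (1 / sigma) ->
  (0 < N)%N /\ exists L, [/\ (0 < L)%N, (N <= 2 ^ L)%N, (2 ^ L <= 2 * N)%N &
    864 * L%:R * a * ln (4 / sigma) <= N%:R].
Proof.
move=> a0 /andP[s0 s1]; rewrite div1r.
set b := ln_max1 a + _; set l := ln_max1 sigma^-1.
have [c c1 cE] : exists2 c : R, 1 <= c & c = 8640 by exists 8640; rewrite ?ler1n.
rewrite -cE => Nb.
have t0 : 0 < ln sigma^-1 by rewrite ln_gt0// invf_gt1.
have l1 : 1 <= l by exact: ln_max1_ge1.
have b1 : 1 <= b.
  by rewrite /b; have := ln_max1_ge1 a; have := ln_max1_ge1 (ln sigma^-1); lra.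
have l0 : 0 < l by exact: lt_le_trans l1.
have b0 : 0 < b by exact: lt_le_trans b1.
have q0 : 0 < a * l by rewrite mulr_gt0.
have qb : a * l <= expR b.
  rewrite /b expRD ler_pM ?(ltW a0) ?(ltW l0) ?le_expR_ln_max1//.
  rewrite {1}/l /ln_max1 ge_max le_expR_ln_max1//=.
  by rewrite -[leLHS]expR0 ler_expR (le_trans ler01)// ln_max1_ge1.
have Nq : 32 * c ^+ 2 * (a * l) * b <= N%:R.
  by apply: le_trans Nb; rewrite le_eqVlt; apply/orP; left; apply/eqP; ring.
have c0 : 0 < c by exact: lt_le_trans c1.
have Nln := ln_inversion c1 q0 b1 qb Nq.
have N0 : (0 < N)%N.
  by rewrite -(ltr_nat R); apply: lt_le_trans Nq; rewrite !mulr_gt0// exprn_gt0.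
split=> //; exists (trunc_log 2 N).+1.
have /andP[lo hi] := trunc_log_bounds (isT : (1 < 2)%N) N0.
have L2 : (2 ^ (trunc_log 2 N).+1 <= 2 * N)%N by rewrite expnS leq_mul2l lo.
split=> //; first exact: ltnW.
set L := (trunc_log 2 N).+1 in L2 *.
have L2R : 2 ^+ L <= 2 * N%:R :> R by rewrite -natrX -natrM ler_nat.
have LN : L%:R <= 2 * ln (2 * N%:R : R).
  have : ln (2 ^+ L) <= ln (2 * N%:R : R).
    by rewrite ler_ln ?posrE ?exprn_gt0 ?mulr_gt0 ?ltr0n.
  rewrite lnXn// -[ln 2 *+ _]mulr_natr => h; have := ln2_ge_half.
  have L0 : 0 <= L%:R :> R by exact: ler0n.
  move=> h2; have h3 : 2^-1 * L%:R <= ln 2 * L%:R :> R by exact: ler_wpM2r.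
  lra.
have l5 : ln (4 / sigma) <= 5 * l.
  rewrite lnM ?posrE ?invr_gt0//.
  have : ln 4 <= 4 :> R by exact: ln_le_id.
  have : ln sigma^-1 <= l by rewrite /l /ln_max1 le_max lexx.
  lra.
have l50 : 0 <= 5 * l by rewrite mulr_ge0// ltW.
apply: le_trans Nln.
apply: (@le_trans _ _ (864 * L%:R * a * (5 * l))).
  have w0 : 0 <= 864 * L%:R * a := mulr_ge0 (mulr_ge0 (ler0n R 864) (ler0n R L)) (ltW a0).
  exact: ler_wpM2l w0 _ _ l5.
have -> : c * (a * l) * ln (2 * N%:R) =
  864 * (2 * ln (2 * N%:R)) * a * (5 * l) by rewrite cE; ring.
apply: ler_wpM2r l50 _ _ _; apply: ler_wpM2r (ltW a0) _ _ _.
exact: ler_wpM2l (ler0n R 864) _ _ LN.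
Qed.

End SampleSize.

(** * Empirical risk minimization *)

Lemma measurable_sublevel {R : realType} {d : measure_display}
  {T : measurableType d} (g : T -> R) (c : R) :
  measurable_fun [set: T] g -> measurable [set s | g s <= c].
Proof.
move=> mg; rewrite (_ : [set s | _] = [set: T] `&` g @^-1` `]-oo, c]%classic).
  exact: mg.
by apply/seteqP; split=> s /=; rewrite in_itv/= => //; case.
Qed.

Lemma measurable_strict_sublevel {R : realType} {d : measure_display}
  {T : measurableType d} (g : T -> R) (c : R) :
  measurable_fun [set: T] g -> measurable [set s | g s < c].
Proof.
move=> mg; rewrite (_ : [set s | _] = [set: T] `&` g @^-1` `]-oo, c[%classic).
  exact: mg.
by apply/seteqP; split=> s /=; rewrite in_itv/= => //; case.
Qed.

(** Markov's inequality for an exponential moment. *)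
Lemma chernoff {R : realType} {d : measure_display} {T : measurableType d}
  (P : probability T R) (g : T -> R) (t K : R) : bmeas g ->
  \int[P]_s expR (g s) <= K ->
  (P (~` [set s | (g s <= t)%R]) <= (K * expR (- t))%:E)%E.
Proof.
move=> bg gK; set A := ~` _.
have mA : measurable A.
  by apply: measurableC; apply: measurable_sublevel; case: bg.
have PA : P A \is a fin_num by exact: fin_num_measure.
have bA : bmeas (\1_A : T -> R).
  split; first exact: measurable_indic.
  by exists 1 => s; rewrite indicE; case: (s \in A); rewrite ?normr1 ?normr0.
have IA : \int[P]_s \1_A s = fine (P A).
  by rewrite /Rintegral integral_indic// setIT.
rewrite -(fineK PA) lee_fin -IA expRN ler_pdivlMr ?expR_gt0// mulrC -bintZ//.
apply: le_trans gK; apply: bint_le.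
- by apply: bmeasM => //; exact: bmeas_cst.
- exact: bmeas_expR.
move=> s; rewrite indicE; case: (boolP (s \in A)) => sA.
  rewrite mulr1 ler_expR ltW// ltNge; move: sA; rewrite inE /A /= => /negP.
  by [].
by rewrite mulr0 expR_ge0.
Qed.

Section EmpiricalRisk.
Context {R : realType} {d N : nat} {dO dE : measure_display}
  {Omega : measurableType dO} {E : measurableType dE}.
Variables (p : \bar R) (mu M : R) (X : set 'rV[R]_d).
Variables (P : probability Omega R) (xi : {RV P >-> E})
  (f : 'rV[R]_d -> E -> R) (xis : 'I_N -> {RV P >-> E}).
Hypothesis p1 : (1 <= p)%E.
Hypothesis mu0 : 0 < mu.
Hypothesis M0 : 0 < M.
Hypothesis N0 : (0 < N)%N.
Hypothesis convX : convex_set X.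
Hypothesis f0 : forall x e, X x -> 0 <= f x e.
Hypothesis fm : forall x, X x -> measurable_fun [set: E] (f x).
Hypothesis fint :
  forall x, X x -> P.-integrable [set: Omega] (fun w => (f x (xi w))%:E).
Hypothesis fL :
  forall x y e, X x -> X y -> `|f y e - f x e| <= M * lp_norm p (y - x).
Hypothesis fconv : forall e, strongly_midconvex p mu X (f ^~ e).
Hypothesis iid : iid_copies xi xis.

Let TT : measurableType _ := N.-tuple E.
Let F := risk f xi.
Let Fh (s : TT) := empirical_risk f s.
Let m (s : TT) := min_over X (Fh s).
Let NR : 0 < N%:R :> R. Proof. by rewrite ltr0n. Qed.
Let u0 : 0 < M / (N%:R * mu). Proof. by rewrite divr_gt0// mulr_gt0. Qed.

Variables (xstar : 'rV[R]_d).
Hypothesis Xstar : X xstar.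
Hypothesis starP : forall y, X y -> F xstar <= F y.

Variable u : nat -> 'rV[R]_d.
Hypothesis Xu : forall k, X (u k).
Hypothesis udense :
  forall y (e : R), X y -> 0 < e -> exists k, lp_norm p (y - u k) < e.

Lemma empirical_lipschitz s x y : X x -> X y ->
  `|Fh s y - Fh s x| <= M * lp_norm p (y - x).
Proof.
move=> Xx Xy; rewrite /Fh /empirical_risk -mulrBr -sumrB normrM.
rewrite (ger0_norm (_ : 0 <= N%:R^-1)) ?invr_ge0 ?ler0n//.
rewrite ler_pdivrMl//; apply: le_trans (ler_norm_sum _ _ _) _.
rewrite mulr_natl -[X in _ <= _ *+ X](card_ord N) -sumr_const.
by apply: ler_sum => k _; exact: fL.
Qed.

Lemma has_inf_empirical s : has_inf [set Fh s x | x in X].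
Proof.
split; first by exists (Fh s xstar); exists xstar.
exists 0 => _ [x Xx <-]; rewrite /Fh /empirical_risk mulr_ge0 ?invr_ge0 ?ler0n//.
by apply: sumr_ge0 => k _; exact: f0.
Qed.

Lemma min_empirical_le s x : X x -> m s <= Fh s x.
Proof.
by move=> Xx; apply: ge_inf; [case: (has_inf_empirical s)|exists x].
Qed.

Lemma min_empirical_adherent s (e : R) : 0 < e ->
  exists k, Fh s (u k) < m s + e.
Proof.
move=> e0; have e20 : 0 < e / 2 by rewrite divr_gt0.
have [_ [x Xx <-] xm] := inf_adherent e20 (has_inf_empirical s).
have [k xk] := udense Xx (divr_gt0 e20 M0).
exists k; have := empirical_lipschitz s Xx (Xu k).
rewrite (lp_norm_sym p (u k)) ler_norml => /andP[_ h].
have : M * lp_norm p (x - u k) < e / 2 by rewrite -ltr_pdivlMl// mulrC.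
by move: xm; rewrite -/(m s); lra.
Qed.

Lemma measurable_empirical x : X x -> measurable_fun [set: TT] (Fh ^~ x).
Proof.
move=> Xx; apply: measurable_funM => //.
apply: measurable_sum => k.
by apply: measurableT_comp; [exact: fm|exact: measurable_tnth].
Qed.

Lemma measurable_min_empirical : measurable_fun [set: TT] m.
Proof.
have lb s : has_lbound (range (fun k => Fh s (u k))).
  by exists (m s) => _ [k _ <-]; exact: min_empirical_le.
rewrite (_ : m = fun s => infs (fun k => Fh s (u k)) 0).
  apply: (measurable_fun_infs (h := fun k s => Fh s (u k))) => [s _|k].
    exact: lb.
  exact: measurable_empirical.
apply/funext => s; apply/eqP; rewrite eq_le; apply/andP; split.
  apply: lb_le_inf; first by exists (Fh s (u 0%N)); exists 0%N.
  by move=> _ [k _ <-]; exact: min_empirical_le.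
apply/ler_addgt0Pr => e e0.
have [k ke] := min_empirical_adherent s e0.
apply: le_trans (ltW ke); apply: ge_inf; last by exists k.
have [c lbc] := lb s; exists c => _ [j _ <-]; apply: lbc.
by exists j.
Qed.

(* [k s] is the index of a near-minimizer drawn from the dense sequence *)
Variable eta : R.
Hypothesis eta_small : 12 * eta / mu <= (M / (N%:R * mu)) ^+ 2.
Variable k : TT -> nat.
Hypothesis kP : forall s, Fh s (u (k s)) < m s + eta.
Hypothesis mk : forall j, measurable [set s | k s = j].

Let a (q : TT * E) := f (u (k q.1)) q.2 - f xstar q.2.
Let b := 9 * (M ^+ 2 / (N%:R * mu)).
Let V := 4 * M ^+ 2 / mu.
Let Q := distribution P xi.

Let diam x y : X x -> X y -> lp_norm p (y - x) <= 4 * M / mu.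
Proof.
move=> Xx Xy.
exact: (strongly_midconvex_diam p1 mu0 M0 convX (fconv point)
  (fun x y => fL point (x := x) (y := y))).
Qed.

Let ba : bmeas a.
Proof.
split.
  apply: measurable_funB.
    apply: (measurable_countable_choice (g := fun j => f (u j))) => // j.
    exact: fm.
  by apply: measurableT_comp => //; exact: fm.
exists (M * (4 * M / mu)) => q; apply: le_trans (fL _ Xstar (Xu _)) _.
by rewrite ler_pM2l// diam.
Qed.

Lemma abarE s : \int[Q]_z a (s, z) = F (u (k s)) - F xstar.
Proof.
rewrite bint_distribution; last exact: bmeas_pairl.
rewrite /F !riskE -RintegralB//; exact: fint.
Qed.

(** Replacing one observation moves the near-minimizer by at most a multiple
of [M / (N * mu)]. *)
Lemma near_minimizer_stable s i z e : `|a (s, e) - a (upd s i z, e)| <= b.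
Proof.
set s' := upd s i z; set x := u (k s); set y := u (k s').
have -> : a (s, e) - a (s', e) = f x e - f y e by rewrite /a /=; ring.
have Xx : X x by exact: Xu.
have Xy : X y by exact: Xu.
set r := lp_norm p (y - x).
have r0 : 0 <= r by exact: lp_norm_ge0.
have D : Fh s y - Fh s x = Fh s' y - Fh s' x + N%:R^-1 *
    ((f y (tnth s i) - f x (tnth s i)) - (f y z - f x z)).
  rewrite /Fh /empirical_risk -!mulrBr -!sumrB -mulrDr; congr (_ * _).
  rewrite (bigD1 i)//= [in RHS](bigD1 i)//= !tnth_upd eqxx.
  rewrite (eq_bigr (fun j => f y (tnth s' j) - f x (tnth s' j))); last first.
    by move=> j ji; rewrite !tnth_upd (negbTE ji).
  by ring.
have d1' := fL (tnth s i) Xx Xy; have d2 := fL z Xx Xy.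
have D2 : Fh s y - Fh s x <= eta + 2 * (M / N%:R) * r.
  have h1 : Fh s' y - Fh s' x <= eta.
    by have := kP s'; have := min_empirical_le s' Xx; rewrite -/y; lra.
  have h2 : N%:R^-1 * ((f y (tnth s i) - f x (tnth s i)) - (f y z - f x z)) <=
      2 * (M / N%:R) * r.
    have -> : 2 * (M / N%:R) * r = N%:R^-1 * (2 * (M * r)) by ring.
    rewrite ler_pM2l ?invr_gt0//.
    move: d1' d2; rewrite -/r !ler_norml => /andP[_ ?] /andP[? _]; lra.
  by rewrite D; lra.
have r2 : r ^+ 2 <= 4 / mu * (3 * eta + 2 * (M / N%:R) * r).
  have sF := strongly_midconvex_empirical fconv N0 s.
  have mle z0 : X z0 -> m s <= Fh s z0 by exact: min_empirical_le.
  apply: le_trans (strongly_midconvex_dist mu0 convX sF mle Xx Xy) _.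
  rewrite ler_wpM2l ?divr_ge0 ?(ltW mu0)//.
  by have := kP s; rewrite -/x -/(Fh s); move: D2; lra.
have := u0; have := eta_small; set w := M / (N%:R * mu) => eta_w w0.
have r3 : r ^+ 2 <= w ^+ 2 + 8 * w * r.
  apply: le_trans r2 _.
  have -> : 4 / mu * (3 * eta + 2 * (M / N%:R) * r) = 12 * eta / mu + 8 * w * r.
    by rewrite /w; field; rewrite !gt_eqF.
  by rewrite lerD2r.
have rw : r <= 9 * w.
  rewrite leNgt; apply/negP => rw.
  have h1 : 9 * w * r < r * r by rewrite ltr_pM2r// (lt_trans _ rw)// mulr_gt0.
  have h2 : w * w < w * r by rewrite ltr_pM2l//; lra.
  by move: r3; rewrite !expr2; lra.
rewrite distrC; apply: le_trans (fL e Xx Xy) _; rewrite -/r.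
have -> : b = M * (9 * w) by rewrite /b /w; ring.
by rewrite ler_pM2l.
Qed.

Lemma near_minimizer_erm s : \sum_(i < N) a (s, tnth s i) <= N%:R * b.
Proof.
have -> : \sum_(i < N) a (s, tnth s i) = N%:R * (Fh s (u (k s)) - Fh s xstar).
  rewrite /Fh /empirical_risk -mulrBr -sumrB mulrA divff ?gt_eqF// mul1r.
  by [].
rewrite ler_pM2l//.
have h1 : Fh s (u (k s)) - Fh s xstar <= eta.
  by have := kP s; have := min_empirical_le s Xstar; lra.
apply: le_trans h1 _.
have N1 : 1 <= N%:R :> R by rewrite ler1n.
have h2 : eta <= N%:R^-1 / 12 * (M ^+ 2 / (N%:R * mu)).
  have -> : N%:R^-1 / 12 * (M ^+ 2 / (N%:R * mu)) =
      mu / 12 * (M / (N%:R * mu)) ^+ 2 by field; rewrite !gt_eqF.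
  have -> : eta = mu / 12 * (12 * eta / mu) by field; rewrite gt_eqF.
  by rewrite ler_pM2l// divr_gt0.
apply: le_trans h2 _; rewrite /b ler_wpM2r//.
  by rewrite divr_ge0 ?sqr_ge0// mulr_ge0// ltW.
rewrite ler_pdivrMr//; apply: (@le_trans _ _ 1); last by lra.
by rewrite invf_le1.
Qed.

Lemma near_minimizer_bernstein s e :
  a (s, e) ^+ 2 <= V * \int[Q]_z a (s, z).
Proof.
rewrite abarE; set x := u (k s).
have h := fL e Xstar (Xu (k s)).
have sF := strongly_midconvex_risk convX fint fconv.
have h2 := strongly_midconvex_dist mu0 convX sF starP Xstar (Xu (k s)).
apply: (@le_trans _ _ (M ^+ 2 * lp_norm p (x - xstar) ^+ 2)).
  rewrite -exprMn -(real_normK (num_real (a _))) lerXn2r// nnegrE//.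
  by rewrite mulr_ge0 ?lp_norm_ge0// ltW.
have -> : V * (F x - F xstar) =
    M ^+ 2 * (4 / mu * (F xstar + F x - 2 * F xstar)) by rewrite /V; ring.
by rewrite ler_wpM2l ?sqr_ge0.
Qed.

Variable S : {mfun Omega >-> TT}.
Hypothesis SE : forall w, S w = sample xis w.

(** High-probability excess risk of the near-minimizers. *)
Lemma near_minimizer_excess (eps sigma : R) (L : nat) : 0 < eps -> 0 < sigma ->
  (0 < L)%N -> (N <= 2 ^ L)%N -> (2 ^ L <= 2 * N)%N ->
  864 * L%:R * (M ^+ 2 / (mu * eps)) * ln (4 / sigma) <= N%:R ->
  (P (~` [set w | (F (u (k (S w))) - F xstar <= eps / 2)%R])
    <= (sigma / 2)%:E)%E.
Proof.
move=> eps0 sigma0 L0 nL Ln big.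
have LR : 1 <= L%:R :> R by rewrite ler1n.
have L0R : 0 < L%:R :> R by lra.
(* the largest exponent for which [48 * L * N * b * lam <= 1] *)
pose lam := mu / (432 * L%:R * M ^+ 2).
have M20 : 0 < M ^+ 2 by rewrite exprn_gt0.
have c432 : 0 < 432 :> R by rewrite ltr0n.
have lam0 : 0 < lam := divr_gt0 mu0 (mulr_gt0 (mulr_gt0 c432 L0R) M20).
have b0 : 0 < b by rewrite mulr_gt0// divr_gt0// mulr_gt0.
have V0 : 0 < V by rewrite divr_gt0// mulr_gt0.
have Vlam : 64 * V * lam <= 1.
  have -> : 64 * V * lam = (256 / 432) / L%:R.
    by rewrite /V /lam; field; rewrite !gt_eqF.
  by rewrite ler_pdivrMr//; lra.
have blam : 48 * L%:R * N%:R * b * lam <= 1.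
  have -> : 48 * L%:R * N%:R * b * lam = 1.
    by rewrite /b /lam; field; rewrite !gt_eqF.
  exact: lexx.
have := stable_excess_moment_le (resampling_sample iid SE) ba b0
  near_minimizer_stable (ltW lam0) near_minimizer_erm near_minimizer_bernstein
  V0 Vlam L0 nL Ln blam.
rewrite -/Q /=; set g := fun s => lam * N%:R * \int[Q]_z a (s, z).
have bg : bmeas g.
  by apply: bmeasM; [exact: bmeas_cst|exact: (bmeas_bint Q ba)].
move=> I2; have := @chernoff _ _ _ (distribution P S) g (lam * N%:R * (eps / 2)) 2 bg I2.
have <- : S @^-1` (~` [set s | g s <= lam * N%:R * (eps / 2)]) =
    ~` [set w | F (u (k (S w))) - F xstar <= eps / 2].
  apply/seteqP; split=> w /= h1 h2; apply: h1; move: h2;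
    by rewrite /g abarE ler_pM2l// mulr_gt0.
move=> /le_trans; apply; rewrite lee_fin expRN.
rewrite ler_pdivrMr ?expR_gt0//.
have e2 : 2 = sigma / 2 * (4 / sigma) by field; rewrite gt_eqF.
rewrite [leLHS]e2 ler_pM2l ?divr_gt0// -[leLHS]lnK ?posrE ?divr_gt0// ler_expR.
have -> : lam * N%:R * (eps / 2) =
    N%:R / (864 * L%:R * (M ^+ 2 / (mu * eps))).
  by rewrite /lam; field; rewrite !gt_eqF.
have c864 : 0 < 864 :> R by rewrite ltr0n.
have a0 := divr_gt0 M20 (mulr_gt0 mu0 eps0).
rewrite ler_pdivlMr; last exact: mulr_gt0 (mulr_gt0 c864 L0R) a0.
by rewrite mulrC.
Qed.

End EmpiricalRisk.

(** * The excess risk of sample average approximation *)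

Theorem mainTheorem1 (R : realType) :
  exists2 C : R, 0 < C & forall M : R, 0 < M ->
  exists2 cM : R, 0 < cM &
  forall (d : nat) (p : \bar R) (mu eps sigma : R)
    (X : set 'rV[R]_d)
    (dO dE : measure_display)
    (Omega : measurableType dO) (E : measurableType dE)
    (P : probability Omega R) (xi : {RV P >-> E})
    (f : 'rV[R]_d -> E -> R)
    (N : nat) (xis : 'I_N -> {RV P >-> E})
    (delta : R) (xhat : N.-tuple E -> 'rV[R]_d),
  (1 <= d)%N -> (1 <= p)%E -> 0 < mu -> 0 < eps -> 0 < sigma < 1 ->
  convex_set X ->
  (forall x e, X x -> 0 <= f x e) ->
  (forall x, X x -> measurable_fun [set: E] (f x)) ->
  (forall x, X x -> P.-integrable [set: Omega] (fun w => (f x (xi w))%:E)) ->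
  (forall x e, X x -> differentiable (f ^~ e) x) ->
  (forall x y e, X x -> X y -> `|f y e - f x e| <= M * lp_norm p (y - x)) ->
  (forall x y e, X x -> X y ->
     f y e >= f x e + dotp (gradient (f ^~ e) x) (y - x)
              + mu / 2 * lp_norm p (y - x) ^+ 2) ->
  attains_min X (risk f xi) ->
  (forall w, attains_min X (empirical_risk f (sample xis w))) ->
  iid_copies xi xis ->
  N%:R >= C * (M ^+ 2 / (mu * eps))
          * (ln_max1 (M ^+ 2 / (mu * eps)) + ln_max1 (ln (1 / sigma)))
          * ln_max1 (1 / sigma) ->
  0 <= delta <= cM * mu * eps ^+ 2 ->
  (forall s, X (xhat s)) ->
  borel_measurable xhat ->
  ((1 - sigma / 2)%:E <=
     P [set w | (empirical_risk f (sample xis w) (xhat (sample xis w))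
                - min_over X (empirical_risk f (sample xis w)) <= delta)%R])%E ->
  ((1 - sigma)%:E <=
     P [set w | (risk f xi (xhat (sample xis w))
                - min_over X (risk f xi) <= eps)%R])%E.
Proof.
exists (32 * 8640 ^+ 2).
  have c32 : 0 < 32 :> R by rewrite ltr0n.
  have c8640 : 0 < 8640 :> R by rewrite ltr0n.
  exact: mulr_gt0 c32 (exprn_gt0 2 c8640).
(* a point within [eps / (2 * M)] has a risk within [eps / 2] *)
move=> M M0; exists (1 / (32 * M ^+ 2)).
  by rewrite divr_gt0// mulr_gt0// exprn_gt0.
move=> d p mu eps sigma X dO dE Omega E P xi f N xis delta xhat d1 p1 mu0 eps0
  sigma01 convX f0 fm fint _ fL fgrad attF _ iid Nbig /andP[delta0 deltale]
  Xhat mhat PA.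
have M20 : 0 < M ^+ 2 by rewrite exprn_gt0.
have [N0 [L [L0 nL Ln big]]] := sample_size
  (divr_gt0 M20 (mulr_gt0 mu0 eps0)) sigma01 Nbig.
clear Nbig; case/andP: sigma01 => sigma0 _.
have NR : 0 < N%:R :> R by rewrite ltr0n.
have fconv e : strongly_midconvex p mu X (f ^~ e).
  by apply: strongly_midconvex_gradient => // x y; exact: fgrad.
have [xstar Xstar starP] := attF.
have [u Xu udense] : exists2 u : nat -> 'rV[R]_d, (forall k, X (u k)) &
    forall y (e : R), X y -> 0 < e -> exists k, lp_norm p (y - u k) < e.
  by apply: lp_dense_sequence => //; exists xstar.
pose S : {mfun Omega >-> N.-tuple E} :=
  HB.pack (sample xis) (isMeasurableFun.Build _ _ _ _ _ (measurable_sample xis)).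
have SE w : S w = sample xis w by [].
(* the tolerance of the near-minimizers: the first bound serves the
stability, the second the comparison with [xhat] *)
pose w0 := M / (N%:R * mu).
have w00 : 0 < w0 by rewrite divr_gt0// mulr_gt0.
pose eta := Num.min (mu / 12 * w0 ^+ 2) (mu * eps ^+ 2 / (32 * M ^+ 2)).
have eta0 : 0 < eta.
  rewrite lt_min; apply/andP; split.
    by rewrite mulr_gt0 ?divr_gt0 ?exprn_gt0.
  by rewrite divr_gt0 ?mulr_gt0 ?exprn_gt0.
have eta1 : 12 * eta / mu <= w0 ^+ 2.
  rewrite ler_pdivrMr//.
  have : eta <= mu / 12 * w0 ^+ 2 by rewrite /eta ge_min lexx.
  by lra.
have eta2 : eta <= mu * eps ^+ 2 / (32 * M ^+ 2).
  by rewrite /eta ge_min lexx orbT.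
have mmin := measurable_min_empirical (N := N) M0 N0 f0 fm fL Xstar Xu udense.
have [k kP mk] : exists2 k : N.-tuple E -> nat,
    forall s, empirical_risk f s (u (k s)) <
      min_over X (empirical_risk f s) + eta &
    forall j, measurable [set s | k s = j].
  apply: (@measurable_first_index _ _ (fun j => [set s : N.-tuple E |
    empirical_risk f s (u j) < min_over X (empirical_risk f s) + eta])).
    move=> j; rewrite (_ : [set s | _] = [set s : N.-tuple E |
      empirical_risk f s (u j) - min_over X (empirical_risk f s) < eta]).
      apply: measurable_strict_sublevel; apply: measurable_funB => //.
      exact: (measurable_empirical fm (Xu j)).
    by apply/seteqP; split=> s /=; rewrite ltrBlDl.
  by move=> s; exact: (min_empirical_adherent M0 N0 f0 fL Xstar Xu udense).
have PB := near_minimizer_excess p1 mu0 M0 N0 convX f0 fm fint fL fconv iid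
  Xstar starP Xu eta1 kP mk SE eps0 sigma0 L0 nL Ln big.
have FL := risk_lipschitz fint fL.
have minF : min_over X (risk f xi) = risk f xi xstar.
  apply/eqP; rewrite eq_le; apply/andP; split.
    apply: ge_inf; last by exists xstar.
    by exists (risk f xi xstar) => _ [y Xy <-]; exact: starP.
  apply: lb_le_inf; first by exists (risk f xi xstar); exists xstar.
  by move=> _ [y Xy <-]; exact: starP.
rewrite minF.
set A := [set w | _] in PA; set G := [set w | _].
set B := [set w | _] in PB.
have mS : measurable_fun [set: Omega] (sample xis) by exact: measurable_sample.
have mA : measurable A.
  apply: (measurable_sublevel (g := fun w => empirical_risk f (sample xis w)
    (xhat (sample xis w)) - min_over X (empirical_risk f (sample xis w)))).
  apply: (measurableT_comp (f := fun s : N.-tuple E =>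
    empirical_risk f s (xhat s) - min_over X (empirical_risk f s))) mS.
  apply: measurable_funB => //; apply: measurable_funM => //.
  apply: measurable_sum => j.
  apply: (measurableT_comp (f := fun q : N.-tuple E * E => f (xhat q.1) q.2)
    (g := fun s : N.-tuple E => (s, tnth s j))).
    exact: (measurable_lipschitz_comp d1 p1 M0 fm fL mhat Xhat).
  by apply: measurable_fun_pair => //; exact: measurable_tnth.
have mG : measurable G.
  apply: (measurable_sublevel (g := fun w =>
    risk f xi (xhat (sample xis w)) - risk f xi xstar)).
  apply: (measurableT_comp (f := fun s : N.-tuple E =>
    risk f xi (xhat s) - risk f xi xstar)) mS.
  apply: measurable_funB => //.
  apply: (measurableT_comp (f := fun q : N.-tuple E * E => risk f xi (xhat q.1))
    (g := fun s : N.-tuple E => (s, point))).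
    apply: (measurable_lipschitz_comp (g := fun x _ => risk f xi x) d1 p1 M0
      _ _ mhat Xhat) => // x y e; exact: FL.
  exact: measurable_fun_pair.
have mB : measurable B.
  apply: (measurable_sublevel (g := fun w =>
    risk f xi (u (k (S w))) - risk f xi xstar)).
  apply: (measurableT_comp (f := fun s : N.-tuple E =>
    risk f xi (u (k s)) - risk f xi xstar)) mS.
  apply: measurable_funB => //.
  apply: (measurableT_comp (f := fun q : N.-tuple E * E => risk f xi (u (k q.1)))
    (g := fun s : N.-tuple E => (s, point))).
    exact: (measurable_countable_choice (g := fun j _ => risk f xi (u j))).
  exact: measurable_fun_pair.
(* a near-minimizer of the empirical risk is close to any other one *)
have AGB : A `<=` G `|` ~` B.
  move=> w Aw; have [Bw|] := pselect (B w); last by right.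
  left; rewrite /G /=; move: Aw Bw; rewrite /A /B /= -SE.
  set s := S w; set x := u (k s); set y := xhat s => Aw Bw.
  have Xx : X x by exact: Xu.
  have Xy : X y by exact: Xhat.
  have sF := strongly_midconvex_empirical fconv N0 s.
  have mle z : X z -> min_over X (empirical_risk f s) <= empirical_risk f s z.
    exact: (min_empirical_le f0 Xstar).
  have D := strongly_midconvex_dist mu0 convX sF mle Xx Xy.
  set r := lp_norm p (y - x) in D.
  have r0 : 0 <= r by exact: lp_norm_ge0.
  have D2 : r ^+ 2 <= 4 / mu * (delta + eta).
    apply: le_trans D _; rewrite ler_wpM2l ?divr_ge0 ?(ltW mu0)//.
    by have := kP s; rewrite -/x; lra.
  have D3 : r ^+ 2 <= (eps / (2 * M)) ^+ 2.
    apply: le_trans D2 _.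
    have -> : (eps / (2 * M)) ^+ 2 = 4 / mu * (1 / (32 * M ^+ 2) * mu * eps ^+ 2
        + mu * eps ^+ 2 / (32 * M ^+ 2)).
      by field; rewrite !gt_eqF.
    by rewrite ler_wpM2l ?divr_ge0 ?(ltW mu0)// lerD.
  have D4 : M * r <= eps / 2.
    have rM : r <= eps / (2 * M).
      by rewrite -(ler_pXn2r (n := 2)) ?nnegrE// divr_ge0 ?mulr_ge0 ?ltW.
    apply: le_trans (ler_wpM2l (ltW M0) rM) _.
    rewrite le_eqVlt; apply/orP; left; apply/eqP.
    by field; rewrite gt_eqF.
  have := FL x y Xx Xy; rewrite -/r ler_norml => /andP[_].
  by move: D4 Bw; lra.
have PGB : (P A <= P G + P (~` B))%E.
  have mCB : measurable (~` B) by exact: measurableC.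
  apply: le_trans (measureU2 P mG mCB).
  by apply: le_measure => //; rewrite inE//; exact: measurableU.
have PGf : P G \is a fin_num by exact: fin_num_measure.
have := le_trans PA (le_trans PGB (leeD2l (P G) PB)).
rewrite -(fineK PGf) -EFinD !lee_fin; lra.
Qed.
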